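(* Let $C$ be a smooth affine connected curve over $k$, let $X$ be its smooth completion and $S=X\setminus C$. Then $$\pi_1^{et}(C)=\varprojlim_P \pi_1(X,P),$$ where $P$ runs over all branch data on $X$ with $\mathrm{Supp}(P)\subset S$.
   Context: Let $k$ be an algebraically closed field of arbitrary characteristic; all curves are over $k$. A covering of smooth projective curves is a finite generically étale (separable) morphism. For a smooth projective curve $X$ and a closed point $x\in X$, $\mathcal{K}_{X,x}$ denotes the fraction field of the completed local ring $\widehat{\mathcal O}_{X,x}$. A branch data on $X$ is a function $P$ assigning to each closed point $x\in X$ a finite Galois extension $P(x)$ of $\mathcal K_{X,x}$ (in a fixed algebraic closure) such that the support $\mathrm{Supp}(P)=\{x: P(x)\ne \mathcal K_{X,x}\}$ is finite. For branch data $P,P'$ on $X$ write $P\ge P'$ if $P(x)\supset P'(x)$ for all closed points $x$. A formal orbifold is a pair $(X,P)$ with $X$ a smooth projective curve and $P$ a branch data on $X$. A covering $f:Y\to X$ is an essentially étale cover of $(X,P)$ if for every closed point $y\in Y$ the field $\mathcal K_{Y,y}$, viewed as an extension of $\mathcal K_{X,f(y)}$, is contained in $P(f(y))$. For $X$ connected, the étale fundamental group is the profinite group $\pi_1(X,P)=\varprojlim \mathrm{Aut}(Y/X)$, the limit being over the (pointed) connected Galois essentially étale covers $Y\to X$ of $(X,P)$. Equivalently, fixing a separable closure of $k(X)$, $\pi_1(X,P)=\mathrm{Gal}(k(X)^{P,un}/k(X))$, where $k(X)^{P,un}$ is the compositum of the function fields of all connected essentially étale covers of $(X,P)$. If $P\ge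 P'$, every essentially étale cover of $(X,P')$ is one of $(X,P)$, which gives the natural transition map $\pi_1(X,P)\to\pi_1(X,P')$. $\pi_1^{et}(C)$ is the usual étale fundamental group of the curve $C$. All fundamental groups are taken with respect to a common base point in $C$. *)

(* Defs.v *)
From HB Require Import structures.
From mathcomp Require Import all_boot all_algebra.
From mathcomp Require Import separable.
From mathcomp Require Import all_classical topology function_spaces.

Set Implicit Arguments.
Unset Strict Implicit.
Unset Printing Implicit Defensive.

Import GRing.Theory.
Local Open Scope classical_set_scope.
Local Open Scope ring_scope.

Identity Coercion set_fun : set >-> Funclass.

Section Subrings.
Variable F : fieldType.
Implicit Types A J m : set F.

Definition is_subring A : Prop :=
  [/\ A 1, (forall x y, A x -> A y -> A (x - y))
    & (forall x y, A x -> A y -> A (x * y))].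

Definition is_subfield A : Prop := is_subring A /\ (forall x, A x -> A x^-1).

Definition fractions A : set F := [set z | exists a b, [/\ A a, A b & z = a / b]].

Definition is_ideal A J : Prop :=
  [/\ J `<=` A, J 0, (forall x y, J x -> J y -> J (x - y))
    & (forall a x, A a -> J x -> J (a * x))].

Definition maximal_ideal A m : Prop :=
  [/\ is_ideal A m, ~ m 1
    & forall J, is_ideal A J -> m `<=` J -> J 1 \/ J `<=` m].

(* the localization [A_m] inside [F], for [m] a prime ideal of [A] *)
Definition local_ring A m : set F :=
  [set z | exists a s, [/\ A a, A s, ~ m s & z = a / s]].

(* the nonunits of [A]; [0^-1 = 0] forces the case [z = 0] apart *)
Definition maxid A : set F := [set z | A z /\ (z = 0 \/ ~ A z^-1)].

(* the power [m^n] of the maximal ideal [m] of [A]: as [m] is principal in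
   all uses, [m^n] is generated by the [t ^+ n] for [t] in [m] *)
Definition maxid_pow A (n : nat) : set F :=
  [set z | exists a t, [/\ A a, maxid A t & z = a * t ^+ n]].

Record dvr := Dvr {
  dvr_set :> set F;
  dvr_subring : is_subring dvr_set;
  dvr_uniformizer : exists t, [/\ dvr_set t, t != 0, ~ dvr_set t^-1 &
    forall z, dvr_set z -> z != 0 ->
      exists n u, [/\ dvr_set u, dvr_set u^-1 & z = u * t ^+ n]]
}.

End Subrings.

Section DvrTheory.
Variables (F : fieldType) (O : dvr F).
Implicit Types (x y z t : F) (n : nat).

Lemma dvr1 : O 1. Proof. by case: (dvr_subring O). Qed.
Lemma dvrB x y : O x -> O y -> O (x - y).
Proof. by case: (dvr_subring O) => _ + _; apply. Qed.
Lemma dvrM x y : O x -> O y -> O (x * y).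
Proof. by case: (dvr_subring O) => _ _; apply. Qed.
Lemma dvr0 : O 0. Proof. by rewrite -(subrr 1); apply: dvrB; apply: dvr1. Qed.
Lemma dvrN x : O x -> O (- x).
Proof. by move=> Ox; rewrite -sub0r; apply: dvrB => //; apply: dvr0. Qed.
Lemma dvrD x y : O x -> O y -> O (x + y).
Proof. by move=> Ox Oy; rewrite -[y]opprK; apply: dvrB => //; apply: dvrN. Qed.
Lemma dvrX x n : O x -> O (x ^+ n).
Proof.
by move=> Ox; elim: n => [|n IHn]; rewrite ?expr0 ?exprS; [apply: dvr1|apply: dvrM].
Qed.

Definition uniformizer t : Prop := [/\ O t, t != 0, ~ O t^-1 &
    forall z, O z -> z != 0 ->
      exists n u, [/\ O u, O u^-1 & z = u * t ^+ n]].

Lemma maxid_uniformizer t : uniformizer t ->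
  maxid O = [set z | exists a, O a /\ z = a * t].
Proof.
case=> Ot t0 tV tP; apply/seteqP; split=> z /=.
  case=> Oz; have [-> _|z0] := eqVneq z 0.
    by exists 0; split; [apply: dvr0|rewrite mul0r].
  case=> [z_eq0|zV]; first by rewrite z_eq0 eqxx in z0.
  have [[|n] [u [Ou OuV zE]]] := tP z Oz z0.
    by case: zV; rewrite zE expr0 mulr1.
  by exists (u * t ^+ n); split; [apply/dvrM/dvrX|rewrite -mulrA -exprSr].
case=> a [Oa ->]; split; first exact: dvrM.
have [->|a0] := eqVneq a 0; first by left; rewrite mul0r.
right; rewrite invfM => /(dvrM Oa); rewrite mulrA mulfV // mul1r.
exact: tV.
Qed.

Lemma maxid_powE t n : uniformizer t ->
  maxid_pow O n = [set z | exists a, O a /\ z = a * t ^+ n].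
Proof.
move=> tU; have [Ot _ _ _] := tU; apply/seteqP; split=> z /=.
  case=> a [s [Oa]]; rewrite (maxid_uniformizer tU) => -[b [Ob ->]] ->.
  by exists (a * b ^+ n); split; [apply/dvrM/dvrX|rewrite exprMn mulrA].
case=> a [Oa ->]; exists a, t; split=> //; rewrite (maxid_uniformizer tU).
by exists 1; split; [apply: dvr1|rewrite mul1r].
Qed.

Lemma maxid_powO n z : maxid_pow O n z -> O z.
Proof. by case=> a [t [Oa [Ot _] ->]]; apply/dvrM/dvrX. Qed.

Lemma maxid_pow0 n : maxid_pow O n 0.
Proof.
exists 0, 0; split; rewrite ?mul0r //; first exact: dvr0.
by split; [exact: dvr0|left].
Qed.

Lemma maxid_powB n x y :
  maxid_pow O n x -> maxid_pow O n y -> maxid_pow O n (x - y).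
Proof.
have [t tU] := dvr_uniformizer O; rewrite (maxid_powE n tU).
case=> a [Oa ->] [b [Ob ->]]; exists (a - b).
by split; [apply: dvrB|rewrite mulrBl].
Qed.

Lemma maxid_powM n x y : O x -> maxid_pow O n y -> maxid_pow O n (x * y).
Proof.
move=> Ox [a [t [Oa mt ->]]]; exists (x * a), t.
by split; [apply: dvrM|by []|rewrite mulrA].
Qed.

Lemma maxid_powMr n x y : O y -> maxid_pow O n x -> maxid_pow O n (x * y).
Proof. by rewrite mulrC; exact: maxid_powM. Qed.

Lemma maxid_powN n x : maxid_pow O n x -> maxid_pow O n (- x).
Proof. by move=> mx; rewrite -sub0r; apply: maxid_powB; first exact: maxid_pow0. Qed.

Lemma maxid_powD n x y :
  maxid_pow O n x -> maxid_pow O n y -> maxid_pow O n (x + y).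
Proof.
by move=> mx my; rewrite -[y]opprK; apply: maxid_powB => //; exact: maxid_powN.
Qed.

Lemma maxid_pow_le m n : (m <= n)%N -> maxid_pow O n `<=` maxid_pow O m.
Proof.
move=> le_mn z [a [t [Oa [Ot mt] ->]]]; exists (a * t ^+ (n - m)), t; split=> //.
  exact/dvrM/dvrX.
by rewrite -mulrA -exprD subnK.
Qed.

Lemma maxid_pow_prime m n x y : O x -> O y ->
  maxid_pow O (m + n) (x * y) -> maxid_pow O m x \/ maxid_pow O n y.
Proof.
move=> Ox Oy; have [t tU] := dvr_uniformizer O; have [Ot t0 tV tP] := tU.
have [-> _|x0] := eqVneq x 0; first by left; exact: maxid_pow0.
have [-> _|y0] := eqVneq y 0; first by right; exact: maxid_pow0.
rewrite !(maxid_powE _ tU) /=.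
have [i [u [Ou OuV xE]]] := tP x Ox x0; have [j [v [Ov OvV yE]]] := tP y Oy y0.
case=> a [Oa]; have [mi _|im] := leqP m i.
  left; exists (u * t ^+ (i - m)); split; first exact/dvrM/dvrX.
  by rewrite -mulrA -exprD subnK.
have [nj _|jn E] := leqP n j.
  right; exists (v * t ^+ (j - n)); split; first exact/dvrM/dvrX.
  by rewrite -mulrA -exprD subnK.
exfalso; apply: tV.
have u0 : u != 0 by apply: contraNneq x0; rewrite xE => ->; rewrite mul0r.
have v0 : v != 0 by apply: contraNneq y0; rewrite yE => ->; rewrite mul0r.
have ltij : (i + j < m + n)%N by rewrite -addnS leq_add // ltnW.
have {E} E : u * v = a * t ^+ (m + n - (i + j)).
  apply: (mulIf (expf_neq0 (i + j) t0)); rewrite -[RHS]mulrA -exprD subnK 1?ltnW //.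
  by rewrite -E xE yE exprD mulrACA.
have -> : t^-1 = a * t ^+ (m + n - (i + j)).-1 * (u^-1 * v^-1).
  apply: (mulIf t0); rewrite mulVf // mulrAC -[a * _ * t]mulrA -exprSr.
  rewrite prednK ?subn_gt0 // -E mulrACA !mulfV ?mulr1 //.
by apply/dvrM/dvrM => //; apply/dvrM/dvrX.
Qed.

End DvrTheory.

(** The completed local ring [lim_n O / m^n]: sequences [f] in [O] with
    [f n.+1 = f n] modulo [m^n], where [f n] stands for its class modulo
    [m^n]; two sequences are identified when they agree modulo [m^n] for
    all [n]. *)
Section Completion.
Variables (F : fieldType) (O : dvr F).

Definition coherent (f : nat -> F) : Prop :=
  forall n, O (f n) /\ maxid_pow O n (f n.+1 - f n).

Definition coherentb : pred (nat -> F) := fun f => `[< coherent f >].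

Lemma coherent_subring : subring_closed coherentb.
Proof.
split.
- by apply/asboolP => n; split; [exact: dvr1|rewrite subrr; exact: maxid_pow0].
- move=> f g /asboolP cf /asboolP cg; apply/asboolP => n.
  have [Of mf] := cf n; have [Og mg] := cg n.
  split; first exact: dvrB.
  have -> : (f - g) n.+1 - (f - g) n = (f n.+1 - f n) - (g n.+1 - g n).
    by rewrite !fctE !opprB addrACA [RHS]addrACA [- g n.+1 - _]addrC.
  exact: maxid_powB.
- move=> f g /asboolP cf /asboolP cg; apply/asboolP => n.
  have [Of mf] := cf n; have [Og mg] := cg n; have [Og' _] := cg n.+1.
  split; first exact: dvrM.
  have -> : (f * g) n.+1 - (f * g) n
      = (f n.+1 - f n) * g n.+1 + f n * (g n.+1 - g n).
    by rewrite !fctE mulrBl mulrBr subrKA.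
  by apply: maxid_powD; [exact: maxid_powMr|exact: maxid_powM].
Qed.

HB.instance Definition _ :=
  GRing.isSubringClosed.Build (nat -> F) coherentb coherent_subring.

Record cseq := Cseq { cseq_fun :> nat -> F; cseqP : coherentb cseq_fun }.
HB.instance Definition _ := [isSub for cseq_fun].
HB.instance Definition _ := [Choice of cseq by <:].
HB.instance Definition _ := [SubChoice_isSubComNzRing of cseq by <:].

Lemma cseqO (f : cseq) n : O (f n).
Proof. by have /asboolP/(_ n)[] := cseqP f. Qed.

Lemma cseq_sub (f : cseq) m n : (m <= n)%N -> maxid_pow O m (f n - f m).
Proof.
move=> /subnK <-; elim: (n - m)%N => [|d IHd].
  by rewrite add0n subrr; exact: maxid_pow0.
rewrite -(subrKA (f (d + m))) addSn; apply: maxid_powD => //.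
have /asboolP/(_ (d + m)%N)[_] := cseqP f.
by apply: maxid_pow_le; exact: leq_addl.
Qed.

Definition nullb : pred cseq := fun f => `[< forall n, maxid_pow O n (f n) >].

Lemma nullb_idealr : idealr_closed nullb.
Proof.
split.
- by apply/asboolP => n; exact: maxid_pow0.
- apply/negP => /asboolP/(_ 1%N); have [t tU] := dvr_uniformizer O.
  have [Ot t0 tV _] := tU; rewrite (maxid_powE _ tU) => -[a [Oa]].
  rewrite expr1 => /(congr1 ( *%R^~ t^-1)); rewrite mulfK //.
  by rewrite [X in X * _](_ : _ = 1) // mul1r => tVE; apply: tV; rewrite tVE.
- move=> h f g /asboolP nf /asboolP ng; apply/asboolP => n.
  by apply: maxid_powD; [apply: maxid_powM => //; exact: cseqO|].
Qed.

Lemma nullb_prime : prime_idealr_closed nullb.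
Proof.
move=> f g /asboolP nfg; apply/orP.
have [/asboolP nf|nf] := pselect (forall n, maxid_pow O n (f n)); first by left.
right; move/existsNP: nf => [m nfm]; apply/asboolP => n.
have /maxid_pow_prime[||fm|gn] := nfg (m + n)%N; try exact: cseqO.
  case: nfm; rewrite -[f m](subKr (f (m + n)%N)).
  by apply: maxid_powB => //; apply: cseq_sub; exact: leq_addr.
rewrite -[g n](subKr (g (m + n)%N)).
by apply: maxid_powB => //; apply: cseq_sub; exact: leq_addl.
Qed.

HB.instance Definition _ := isIdealr.Build cseq nullb nullb_idealr.
HB.instance Definition _ := isPrimeIdealrClosed.Build cseq nullb nullb_prime.

Definition null_ideal : prime_idealr cseq := nullb.

Definition completed_ring : Type := {ideal_quot null_ideal}.
HB.instance Definition _ := GRing.ComNzRing.on completed_ring.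

Definition completed_unit : pred completed_ring :=
  fun x => `[< exists y, y * x = 1 >].
Definition completed_inv (x : completed_ring) : completed_ring :=
  if pselect (exists y, y * x = 1) is left ex then projT1 (cid ex) else x.

Lemma completed_mulVx : {in completed_unit, left_inverse 1 completed_inv *%R}.
Proof.
move=> x /asboolP ex; rewrite /completed_inv.
by case: pselect => // ex'; case: cid.
Qed.

Lemma completed_unitPl x y : y * x = 1 -> completed_unit x.
Proof. by move=> yx; apply/asboolP; exists y. Qed.

Lemma completed_inv_out : {in [predC completed_unit], completed_inv =1 id}.
Proof.
move=> x /negP nx; rewrite /completed_inv; case: pselect => // ex.
by case: nx; apply/asboolP.
Qed.

HB.instance Definition _ := GRing.ComNzRing_hasMulInverse.Build completed_ring
  completed_mulVx completed_unitPl completed_inv_out.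
HB.instance Definition _ := GRing.ComUnitRing_isIntegral.Build completed_ring
  (@Quotient.rquot_IdomainAxiom cseq null_ideal).

Definition completed_field : Type := {fraction completed_ring}.
HB.instance Definition _ := GRing.Field.on completed_field.

Definition completed_class (f : cseq) : completed_field :=
  FracField.tofrac (\pi_({ideal_quot null_ideal})%qT f : completed_ring).

End Completion.

Section Galois.
Variable M : fieldType.
Implicit Types B E : set M.

Definition coefs_in B (p : {poly M}) : Prop := forall i, B p`_i.

Definition finite_ext B E : Prop :=
  exists s : seq M, E = [set z | exists2 a : nat -> M,
    (forall i, B (a i)) & z = \sum_(i < size s) a i * s`_i].

(* separable and normal: every element of [E] is a root of a separable
   polynomial over [B] that splits in [E] *)
Definition separable_normal B E : Prop :=
  forall z, E z -> exists p : {poly M},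
    [/\ coefs_in B p, separable_poly p, root p z
      & exists r : seq M, (forall a, a \in r -> E a) /\
          p %= \prod_(a <- r) ('X - a%:P)].

Definition finite_galois B E : Prop :=
  [/\ is_subfield E, B `<=` E, finite_ext B E & separable_normal B E].

(* the ambient field is a separable closure of [B] *)
Definition separable_closure B : Prop :=
  (forall z : M, exists p, [/\ coefs_in B p, separable_poly p & root p z]) /\
  (forall p : {poly M}, separable_poly p -> size p != 1%N -> exists z, root p z).

End Galois.

Record alg_closure (F : fieldType) := AlgClosure {
  ac_field :> closedFieldType;
  ac_emb : {rmorphism F -> ac_field};
  ac_algebraic : forall z, algebraicOver ac_emb z
}.

(* [Om] is a big field containing the base field [k] (via [c]); all the function
  fields are subfields of [Om].  A smooth projective connected curve with
  function field [L] is modelled by the abstract nonsingular curve of [L/k]: its closed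
  points are the discrete valuation rings of [L/k], each one being the local
  ring of the point it represents.  A covering of connected such curves is a
  finite separable extension of function fields, the point [y] being mapped to
  the point [x] whose local ring is the trace of that of [y]. *)
Section Curves.
Variables (k : closedFieldType) (Om : fieldType) (c : {rmorphism k -> Om}).

(* [Spec coord_ring], where [coord_ring] is a finitely generated [k]-algebra
   which is a domain, has transcendence degree 1 over [k], and all of whose
   localizations at maximal ideals are regular, i.e. have a principal maximal
   ideal (over the algebraically closed [k], regular means smooth) *)
Record smooth_affine_curve := SmoothAffineCurve {
  coord_ring : set Om;
  coord_subring : is_subring coord_ring;
  coord_scalar : range c `<=` coord_ring;
  coord_fg : exists s : seq Om, (forall a, a \in s -> coord_ring a) /\
    forall B, is_subring B -> range c `<=` B -> (forall a, a \in s -> B a) ->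
      coord_ring `<=` B;
  coord_transcendental : exists t, coord_ring t /\ ~ algebraicOver c t;
  coord_trdeg_le1 : forall s t, coord_ring s -> coord_ring t ->
    exists2 p : {poly {poly k}}, p != 0 &
      (map_poly (fun q => (map_poly c q).[s]) p).[t] = 0;
  coord_regular : forall m, maximal_ideal coord_ring m ->
    exists t, m t /\ forall a, m a ->
      exists s b, [/\ coord_ring s, ~ m s, coord_ring b & s * a = t * b]
}.

Definition function_field (C : smooth_affine_curve) : set Om :=
  fractions (coord_ring C).

Record closed_point (L : set Om) := ClosedPoint {
  point_ring :> dvr Om;
  point_scalar : range c `<=` point_ring;
  point_fractions : fractions point_ring = L
}.

(* the closed points of the smooth completion lying on [C] *)
Definition on_curve C (x : closed_point (function_field C)) : Prop :=
  exists m, maximal_ideal (coord_ring C) m /\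
    x = local_ring (coord_ring C) m :> set Om.

Definition punctures C : set (closed_point (function_field C)) :=
  [set x | ~ on_curve x].

Section Coverings.
Variables K L : set Om.

(* [lies_over y x] : the covering maps [y] to [x] *)
Definition lies_over (y : closed_point L) (x : closed_point K) : Prop :=
  x = y `&` K :> set Om.

(* the covering is etale at [y], i.e. [m_x] generates [m_y]; the local rings are
   discrete valuation rings with residue field [k], so that flatness and
   separability of the residue extension are automatic, and [m_x] is principal *)
Definition etale_at (y : closed_point L) (x : closed_point K) : Prop :=
  forall z, maxid y z -> exists a b, [/\ maxid x a, y b & z = a * b].

Lemma over_coherent y x (yx : lies_over y x) f : coherent x f -> coherent y f.
Proof.
have xE z : x z <-> y z /\ K z by rewrite [X in X z]yx.
have KV z : K z -> K z^-1.
  rewrite -(point_fractions x) => -[a [b [xa xb ->]]].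
  by exists b, a; rewrite invf_div.
move=> cf n; have [/xE[yf _] [a [t [/xE[ya _] [/xE[yt Kt] tV] fE]]]] := cf n.
split=> //; exists a, t; split=> //; split=> //.
case: tV => [|tV]; [by left|right=> ytV; apply: tV].
by apply/xE; split=> //; exact: KV.
Qed.

Definition over_cseq y x (yx : lies_over y x) (f : cseq x) : cseq y :=
  Cseq (asboolT (over_coherent yx (asboolW (cseqP f)))).

(* the completed field of [y], as an extension of that of [x], is contained in
   the subset [E] of the algebraic closure [M]: it has an embedding into [M] over
   the completed field of [x] (which is the fraction field of the ring of all
   [completed_class f]) with image in [E].  When [E] is Galois this does not
   depend on the embedding. *)
Definition completed_field_in y x (yx : lies_over y x)
    (M : alg_closure (completed_field x)) (E : set M) : Prop :=
  exists2 phi : {rmorphism completed_field y -> M},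
    (forall f : cseq x,
      phi (completed_class (over_cseq yx f)) = ac_emb M (completed_class f))
    & range phi `<=` E.

End Coverings.

Section BranchData.
Variables (K : set Om)
  (Kbar : forall x : closed_point K, alg_closure (completed_field x)).

Definition Supp (P : forall x, set (Kbar x)) : set (closed_point K) :=
  [set x | P x <> range (ac_emb (Kbar x))].

Record branch_data := BranchData {
  branch_at :> forall x, set (Kbar x);
  branch_galois : forall x, finite_galois (range (ac_emb (Kbar x))) (@branch_at x);
  branch_finite : finite_set (Supp (@branch_at))
}.
Arguments branch_at : clear implicits.

Definition branch_le (P' P : branch_data) : Prop := forall x, P' x `<=` P x.

End BranchData.

(* The base point is the geometric generic point given by [Om], so that the
  pointed connected Galois coverings of the curve with function field [K] are the
  finite Galois subextensions of [Om/K]. *)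
Record galois_cover (K : set Om) := GaloisCover {
  cover_field :> set Om;
  cover_galois : finite_galois K cover_field
}.

Section Aut.
Variables (K : set Om) (L : galois_cover K).
Local Notation carrier := {z : Om | L z}.

Lemma carrier_inj (u v : carrier) : sval u = sval v -> u = v.
Proof. by case: u v => u Lu [v Lv] /= uv; exact: eq_exist. Qed.

Definition is_aut (s : carrier -> carrier) : Prop :=
  [/\ bijective s,
      (forall u v w, sval w = sval u + sval v ->
        sval (s w) = sval (s u) + sval (s v)),
      (forall u v w, sval w = sval u * sval v ->
        sval (s w) = sval (s u) * sval (s v))
    & (forall u, K (sval u) -> s u = u)].

Record aut := MkAut { aut_fun :> carrier -> carrier; autP : is_aut aut_fun }.

HB.instance Definition _ := gen_eqMixin aut.
HB.instance Definition _ := gen_choiceMixin aut.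

Lemma aut_ext (s t : aut) : s =1 t -> s = t.
Proof.
case: s t => [s sP] [t tP] /= /funext st; move: sP tP; rewrite st => sP tP.
by congr MkAut; exact: Prop_irrelevance.
Qed.

Lemma is_aut_id : is_aut id. Proof. by split=> //; exists id. Qed.

Lemma is_aut_comp (s t : aut) : is_aut (s \o t).
Proof.
have [sb sD sM sK] := autP s; have [tb tD tM tK] := autP t.
split=> [||| u Ku] /=; first exact: bij_comp.
- by move=> u v w /tD/sD.
- by move=> u v w /tM/sM.
- by rewrite tK // sK.
Qed.

Lemma aut_inv_ex (s : aut) : exists t : aut, cancel s t /\ cancel t s.
Proof.
have [[L1 LB LM] _] : is_subfield L by case: (cover_galois L).
have [[g sg gs] sD sM sK] := autP s.
have LD x y : L x -> L y -> L (x + y).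
  move=> Lx Ly; rewrite -[y]opprK; apply: (LB) => //; rewrite -sub0r.
  by apply: (LB) => //; rewrite -(subrr 1); exact: (LB).
suff gP : is_aut g by exists (MkAut gP).
split; first by exists s.
- move=> u v w uvw; pose z : carrier := exist _ _ (LD _ _ (svalP (g u)) (svalP (g v))).
  rewrite -[RHS]/(sval z); congr sval; rewrite -[RHS]sg; congr g.
  by apply: carrier_inj; rewrite uvw (sD (g u) (g v) z) // !gs.
- move=> u v w uvw; pose z : carrier := exist _ _ (LM _ _ (svalP (g u)) (svalP (g v))).
  rewrite -[RHS]/(sval z); congr sval; rewrite -[RHS]sg; congr g.
  by apply: carrier_inj; rewrite uvw (sM (g u) (g v) z) // !gs.
- by move=> u Ku; rewrite -{1}(sK u Ku) sg.
Qed.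

Definition aut_mul (s t : aut) : aut := MkAut (is_aut_comp s t).
Definition aut_inv (s : aut) : aut := projT1 (cid (aut_inv_ex s)).

Lemma aut_mulA : associative aut_mul.
Proof. by move=> s t u; apply: aut_ext. Qed.
Lemma aut_mul1 : left_id (MkAut is_aut_id) aut_mul.
Proof. by move=> s; apply: aut_ext. Qed.
Lemma aut_1mul : right_id (MkAut is_aut_id) aut_mul.
Proof. by move=> s; apply: aut_ext. Qed.
Lemma aut_mulV : left_inverse (MkAut is_aut_id) aut_inv aut_mul.
Proof.
by move=> s; rewrite /aut_inv; case: cid => t [st ts]; apply: aut_ext => u /=.
Qed.
Lemma aut_Vmul : right_inverse (MkAut is_aut_id) aut_inv aut_mul.
Proof.
by move=> s; rewrite /aut_inv; case: cid => t [st ts]; apply: aut_ext => u /=.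
Qed.

HB.instance Definition _ := isGroup.Build aut
  aut_mulA aut_mul1 aut_1mul aut_mulV aut_Vmul.

End Aut.

(* The inverse limit of the groups [aut L], for [L] in a class [Q] of pointed
   connected Galois coverings.  The product of [aut L] is the composition of
   automorphisms of [L], as in the Galois group [Gal(L/K)].  A morphism of
   pointed coverings is an inclusion [L `<=` L'] inside [Om], and its transition
   map is the restriction. *)
Section Pi1.
Variable K : set Om.
Implicit Types Q : set (galois_cover K).

Record pi1 Q := Pi1 {
  pi1_fun :> forall L : {L | Q L}, aut (sval L);
  pi1_compat : forall (L L' : {L | Q L})
      (u : {z | sval L z}) (v : {z | sval L' z}),
    sval L `<=` sval L' -> sval u = sval v ->
    sval (pi1_fun L u) = sval (pi1_fun L' v)
}.

HB.instance Definition _ Q := gen_eqMixin (pi1 Q).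
HB.instance Definition _ Q := gen_choiceMixin (pi1 Q).

Lemma pi1_ext Q (s t : pi1 Q) : (forall L, s L = t L) -> s = t.
Proof.
case: s t => [s sP] [t tP] /= st; have {}st := functional_extensionality_dep st.
by subst t; congr Pi1; exact: Prop_irrelevance.
Qed.

(* the subspace topology of the product of the discrete groups [aut L] *)
HB.instance Definition _ Q := Topological.copy (pi1 Q)
  (initial_topology (fun s : pi1 Q =>
    (fun L => s L) : prod_topology (fun L : {L | Q L} =>
      discrete_topology (aut (sval L))))).

Definition pi1_one Q : pi1 Q.
Proof. by exists (fun L => 1%g) => L L' u v. Defined.

Definition pi1_mul Q (s t : pi1 Q) : pi1 Q.
Proof.
exists (fun L => (s L * t L)%g) => L L' u v LL' uv.
exact: (pi1_compat s (u := t L u) (v := t L' v) LL' (pi1_compat t LL' uv)).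
Defined.

Definition pi1_inv Q (s : pi1 Q) : pi1 Q.
Proof.
exists (fun L => (s L)^-1%g) => L L' u v LL' uv.
have aVK (N : galois_cover K) (a : aut N) z : a (a^-1%g z) = z.
  by rewrite -[LHS]/((a * a^-1)%g z) mulgV.
have aK (N : galois_cover K) (a : aut N) z : a^-1%g (a z) = z.
  by rewrite -[LHS]/((a^-1 * a)%g z) mulVg.
pose w : {z | sval L' z} := exist _ _ (LL' _ (svalP ((s L)^-1%g u))).
have sw : s L' w = v.
  apply: carrier_inj; rewrite -uv -[u in RHS](aVK _ (s L)).
  by symmetry; exact: (pi1_compat s).
by rewrite -sw aK.
Defined.

Lemma pi1_mulA Q : associative (@pi1_mul Q).
Proof. by move=> s t u; apply: pi1_ext => L /=; rewrite mulgA. Qed.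
Lemma pi1_mul1 Q : left_id (pi1_one Q) (@pi1_mul Q).
Proof. by move=> s; apply: pi1_ext => L /=; rewrite mul1g. Qed.
Lemma pi1_1mul Q : right_id (pi1_one Q) (@pi1_mul Q).
Proof. by move=> s; apply: pi1_ext => L /=; rewrite mulg1. Qed.
Lemma pi1_mulV Q : left_inverse (pi1_one Q) (@pi1_inv Q) (@pi1_mul Q).
Proof. by move=> s; apply: pi1_ext => L /=; rewrite mulVg. Qed.
Lemma pi1_Vmul Q : right_inverse (pi1_one Q) (@pi1_inv Q) (@pi1_mul Q).
Proof. by move=> s; apply: pi1_ext => L /=; rewrite mulgV. Qed.

HB.instance Definition _ Q := isGroup.Build (pi1 Q)
  (@pi1_mulA Q) (@pi1_mul1 Q) (@pi1_1mul Q) (@pi1_mulV Q) (@pi1_Vmul Q).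

Definition pi1_trans Q Q' (QQ' : Q' `<=` Q) (s : pi1 Q) : pi1 Q'.
Proof.
exists (fun L => s (exist _ (sval L) (QQ' _ (svalP L)))) => L L' u v LL' uv.
exact: (pi1_compat s (L := exist _ _ _) (L' := exist _ _ _)).
Defined.

End Pi1.

Definition etale_over C : set (galois_cover (function_field C)) :=
  [set L | forall (y : closed_point L) (x : closed_point (function_field C)),
    lies_over y x -> on_curve x -> etale_at y x].

Definition pi1_etale C := pi1 (@etale_over C).

Section FormalOrbifold.
Variables (K : set Om)
  (Kbar : forall x : closed_point K, alg_closure (completed_field x)).

Definition essentially_etale (P : branch_data Kbar) : set (galois_cover K) :=
  [set L | forall (y : closed_point L) x (yx : lies_over y x),
    completed_field_in yx (P x)].

Definition pi1_orbifold (P : branch_data Kbar) := pi1 (essentially_etale P).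

Lemma essentially_etale_le (P P' : branch_data Kbar) :
  branch_le P' P -> essentially_etale P' `<=` essentially_etale P.
Proof.
move=> PP' L eL y x yx; have [phi phiE phiP] := eL y x yx.
by exists phi => //; apply: subset_trans phiP _; exact: PP'.
Qed.

Definition pi1_orbifold_trans (P P' : branch_data Kbar) (PP' : branch_le P' P) :
  pi1_orbifold P -> pi1_orbifold P' := pi1_trans (essentially_etale_le PP').

(* the inverse limit of the groups [pi1_orbifold P] over the branch data [P] with
   support in [S], ordered by [branch_le] *)
Section Limit.
Variable S : set (closed_point K).
Local Notation index := {P : branch_data Kbar | Supp P `<=` S}.

Record lim_pi1 := LimPi1 {
  lim_pi1_fun :> forall P : index, pi1_orbifold (sval P);
  lim_pi1_compat : forall (P P' : index) (PP' : branch_le (sval P') (sval P)),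
    pi1_orbifold_trans PP' (lim_pi1_fun P) = lim_pi1_fun P'
}.

HB.instance Definition _ := gen_eqMixin lim_pi1.
HB.instance Definition _ := gen_choiceMixin lim_pi1.

Lemma lim_pi1_ext (s t : lim_pi1) : (forall P, s P = t P) -> s = t.
Proof.
case: s t => [s sP] [t tP] /= st; have {}st := functional_extensionality_dep st.
by subst t; congr LimPi1; exact: Prop_irrelevance.
Qed.

HB.instance Definition _ := Topological.copy lim_pi1
  (initial_topology (fun s : lim_pi1 =>
    (fun P => s P) : prod_topology (fun P : index => pi1_orbifold (sval P)))).

Definition lim_pi1_one : lim_pi1.
Proof. by exists (fun P => pi1_one _) => P P' PP'; apply: pi1_ext. Defined.

Definition lim_pi1_mul (s t : lim_pi1) : lim_pi1.
Proof.
exists (fun P => pi1_mul (s P) (t P)) => P P' PP'.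
by rewrite -!(lim_pi1_compat _ PP'); apply: pi1_ext.
Defined.

Definition lim_pi1_inv (s : lim_pi1) : lim_pi1.
Proof.
exists (fun P => pi1_inv (s P)) => P P' PP'.
by rewrite -(lim_pi1_compat _ PP'); apply: pi1_ext.
Defined.

Lemma lim_pi1_mulA : associative lim_pi1_mul.
Proof. by move=> s t u; apply: lim_pi1_ext => P /=; exact: pi1_mulA. Qed.
Lemma lim_pi1_mul1 : left_id lim_pi1_one lim_pi1_mul.
Proof. by move=> s; apply: lim_pi1_ext => P /=; exact: pi1_mul1. Qed.
Lemma lim_pi1_1mul : right_id lim_pi1_one lim_pi1_mul.
Proof. by move=> s; apply: lim_pi1_ext => P /=; exact: pi1_1mul. Qed.
Lemma lim_pi1_mulV : left_inverse lim_pi1_one lim_pi1_inv lim_pi1_mul.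
Proof. by move=> s; apply: lim_pi1_ext => P /=; exact: pi1_mulV. Qed.
Lemma lim_pi1_Vmul : right_inverse lim_pi1_one lim_pi1_inv lim_pi1_mul.
Proof. by move=> s; apply: lim_pi1_ext => P /=; exact: pi1_Vmul. Qed.

HB.instance Definition _ := isGroup.Build lim_pi1
  lim_pi1_mulA lim_pi1_mul1 lim_pi1_1mul lim_pi1_mulV lim_pi1_Vmul.

End Limit.
End FormalOrbifold.

End Curves.

Arguments punctures {k Om c} C.
Arguments etale_over {k Om c} C.

(* Main.v *)
(* The map is the restriction of compatible families of automorphisms. Over a point
   of [C], a branch datum supported outside [C] is trivial, so that a cover
   dominated by it has unramified completions there: it is etale over [C].
   Conversely a Galois cover [L] which is etale over [C] is dominated by the
   branch datum that is trivial on [C] and given at each of the finitely many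
   punctures [x] by the splitting field, over the completed field of [x], of
   separable polynomials over [K] whose roots generate [L]. Since branch data have
   upper bounds (composita), the automorphism of [L] read off a compatible family
   does not depend on the branch datum chosen to dominate [L].

   Locally, the residue fields are [k]; if [w] and [t] are uniformizers at [x]
   and at [y] over [x], then [w = u t^e] with [u] a unit, and expanding in digits
   shows that the completion at [y] is generated by [1, t, .., t^(e-1)] over the
   completion at [x]. Hence the completed field of [y] is [K_x(t)], and it equals
   [K_x] exactly when [e = 1], i.e. when [y] is etale over [x]. There are finitely
   many punctures because each one is a pole of a generator [s] of the coordinate
   ring, and approximation makes distinct poles of [s] contribute linearly
   independent functions over [k(1/s)]. *)
Require Import Defs.
From HB Require Import structures.
From mathcomp Require Import all_boot all_algebra.
From mathcomp Require Import falgebra fieldext separable galois.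
From mathcomp Require Import ring.
From mathcomp Require Import all_classical topology function_spaces.

Set Implicit Arguments.
Unset Strict Implicit.
Unset Printing Implicit Defensive.

Import GRing.Theory.
Local Open Scope classical_set_scope.
Local Open Scope ring_scope.

(** * Finite extensions inside a field *)

Lemma mem_subringD (F : fieldType) (S : set F) : is_subring S ->
  forall x y, S x -> S y -> S (x + y).
Proof.
case=> S1 SB _ x y Sx Sy; rewrite -[y]opprK; apply: (SB) => //.
by rewrite -sub0r; apply: (SB) => //; rewrite -(subrr 1); apply: (SB).
Qed.

Lemma mem_subring0 (F : fieldType) (S : set F) : is_subring S -> S 0.
Proof. by case=> S1 SB _; rewrite -(subrr 1); apply: (SB). Qed.

Lemma mem_subringX (F : fieldType) (S : set F) : is_subring S ->
  forall x n, S x -> S (x ^+ n).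
Proof.
by case=> S1 _ SM x n Sx; elim: n => [|n IHn]; rewrite ?expr0 ?exprS //; apply: SM.
Qed.

Lemma mem_subring_sum (F : fieldType) (S : set F) : is_subring S ->
  forall I (r : seq I) (P : pred I) (f : I -> F),
  (forall i, P i -> S (f i)) -> S (\sum_(i <- r | P i) f i).
Proof.
move=> Sring I r P f Sf; elim/big_ind: _ => //; first exact: mem_subring0.
exact: mem_subringD.
Qed.

Lemma mem_subring_horner (F : fieldType) (S : set F) : is_subring S ->
  forall (p : {poly F}) x, (forall i, S p`_i) -> S x -> S p.[x].
Proof.
move=> Sring p x Sp Sx; rewrite horner_coef; apply: mem_subring_sum => // i _.
by case: (Sring) => _ _; apply=> //; apply: mem_subringX.
Qed.

Lemma min_poly_exists (F M : fieldType) (iota : {rmorphism F -> M}) x :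
  algebraicOver iota x ->
  exists q : {poly F}, [/\ q != 0, root (map_poly iota q) x &
    forall r, root (map_poly iota r) x -> r != 0 -> (size q <= size r)%N].
Proof.
case=> p p0 px; pose P n := `[< exists q : {poly F},
  [/\ q != 0, root (map_poly iota q) x & size q = n] >].
have exP : exists n, P n by exists (size p); apply/asboolP; exists p.
case: (ex_minnP exP) => n /asboolP[q [q0 qx <-]] qmin.
by exists q; split=> // r rx r0; apply: qmin; apply/asboolP; exists r.
Qed.

(* The subring of [M] generated over [F] by finitely many algebraic elements
   is an abstract finite extension of [F]. *)
Lemma adjoin_seq_exists (F M : fieldType) (iota : {rmorphism F -> M})
    (rs : seq M) : (forall x, x \in rs -> algebraicOver iota x) ->
  exists (E : fieldExtType F) (j : {rmorphism E -> M}),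
    [/\ forall a, j a%:A = iota a,
        forall x, x \in rs -> exists y, j y = x
      & forall S : set M, is_subring S -> range iota `<=` S ->
          (forall x, x \in rs -> S x) -> range j `<=` S].
Proof.
elim: rs => [_|x rs IHrs algrs].
  exists F^o, iota; split=> // a.
  by congr (iota _); apply: mulr1.
have [x0 x0rs|E [j [jA jrs jmin]]] := IHrs.
  by apply: algrs; rewrite inE x0rs orbT.
have algx : algebraicOver j x.
  have [|p p0 px] := algrs x; first by rewrite inE eqxx.
  exists (map_poly (in_alg E) p); first by rewrite map_poly_eq0.
  by rewrite -map_poly_comp (@eq_map_poly _ _ (j \o in_alg E) iota).
have [q [q0 qx qmin]] := min_poly_exists algx.
have irr_q : irreducible_poly q by apply/(subfx_irreducibleP qx q0).
(* [E'] is [E[X]/(q)], an extension of [E]; [baseFieldType] regards it as an extension of [F]. *)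
pose E' := SubFieldExtType qx irr_q.
pose j' : {rmorphism E' -> M} := @subfx_inj E M j x q.
exists (baseFieldType E'), j'; split=> [a|y|S Sring iS Srs].
- rewrite -jA; exact: (subfx_inj_base qx q0 a%:A).
- rewrite inE => /predU1P[->|/jrs[z <-]].
    by exists (subfx_root j x q); exact: subfx_inj_root.
  by exists (z%:A : E'); rewrite -(subfx_inj_base qx q0 z).
- move=> _ [z _ <-]; have [r ->] := subfxE z.
  rewrite [j' _](subfx_inj_eval qx q0); apply: mem_subring_horner => // [i|].
    rewrite coef_map /=; apply: jmin => // x0 x0rs.
    by apply: Srs; rewrite inE x0rs orbT.
  by apply: Srs; rewrite inE eqxx.
Qed.

Lemma coefs_in_range (F M : fieldType) (iota : {rmorphism F -> M}) p :
  coefs_in (range iota) p <-> exists q : {poly F}, p = map_poly iota q.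
Proof.
split=> [pF|[q -> i]]; last by exists q`_i; rewrite // coef_map.
have /choice[a aE] i : exists a, iota a = p`_i by have [a _ <-] := pF i; exists a.
exists (\poly_(i < size p) a i); apply/polyP => i.
rewrite coef_map coef_poly; case: ltnP => ip; first exact/esym/aE.
by rewrite raddf0 nth_default.
Qed.

Lemma range_subfield (F M : fieldType) (j : {rmorphism F -> M}) :
  is_subfield (range j).
Proof.
split; first split.
- by exists 1; rewrite ?rmorph1.
- by move=> _ _ [x _ <-] [y _ <-]; exists (x - y); rewrite ?rmorphB.
- by move=> _ _ [x _ <-] [y _ <-]; exists (x * y); rewrite ?rmorphM.
- by move=> _ [x _ <-]; exists x^-1; rewrite ?fmorphV.
Qed.

Lemma map_poly_prod_XsubC (F M : fieldType) (j : {rmorphism F -> M}) (r : seq F) :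
  map_poly j (\prod_(a <- r) ('X - a%:P)) = \prod_(a <- map j r) ('X - a%:P).
Proof.
by rewrite rmorph_prod big_map; apply: eq_bigr => a _; exact: map_polyXsubC.
Qed.

Section SplittingRange.
Variables (F : fieldType) (E : splittingFieldType F) (M : fieldType).
Variables (iota : {rmorphism F -> M}) (j : {rmorphism E -> M}).
Hypotheses (jA : forall a, j a%:A = iota a) (sepE : separable 1 {:E}).

(** A basis of [E] over [F] spans the image, and the polynomial attached to an element is its
    minimal polynomial: it is separable by [sepE] and splits because [E] is a splitting field. *)
Lemma range_finite_galois : finite_galois (range iota) (range j).
Proof.
split; first exact: range_subfield.
- by move=> _ [a _ <-]; exists a%:A.
- pose n := \dim {:E}; exists (map j (vbasis {:E})); rewrite size_map size_tuple.
  apply/seteqP; split=> [_ [v _ <-]|_ [a aF ->]].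
    (* [finite_ext] asks for coefficients at every natural number; those past the end of the basis
       are set to [0]. *)
    exists (fun i =>
      if insub i is Some i' then iota (coord (vbasis {:E}) i' v) else 0).
      move=> i; case: insubP => [i' _ _|_].
        by exists (coord (vbasis {:E}) i' v).
      by exists 0; rewrite ?rmorph0.
    rewrite {1}(coord_vbasis (memvf v)) rmorph_sum; apply: eq_bigr => i _ /=.
    rewrite insubT // => ni; rewrite (nth_map 0) ?size_tuple //.
    rewrite -mulr_algl rmorphM /= jA; congr (iota (coord _ _ _) * _).
    exact: val_inj.
  have /choice[b bE] i : exists b, iota b = a i by have [b _ <-] := aF i; exists b.
  exists (\sum_(i < n) b i *: (vbasis {:E})`_i) => //.
  rewrite rmorph_sum; apply: eq_bigr => i _ /=.
  by rewrite -mulr_algl rmorphM /= jA bE (nth_map 0) ?size_tuple.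
- move=> _ [v _ <-]; exists (map_poly j (minPoly 1 v)); split.
  + apply/coefs_in_range; have /polyOver1P[q ->] := minPolyOver 1%AS v.
    by exists q; rewrite -map_poly_comp; apply: eq_map_poly => a; exact: jA.
  + rewrite separable_map.
    by have /separableP/(_ v (memvf v)) := sepE.
  + by rewrite fmorph_root root_minPoly.
  + have [r /eqP->] := splitting_field_normal 1%AS v.
    exists (map j r); split; last by rewrite map_poly_prod_XsubC eqpxx.
    by move=> _ /mapP[a _ ->]; exists a.
Qed.

End SplittingRange.

(** The hull is the splitting field in [M] of the product [P] of the given polynomials. [P] itself
    may have multiple roots, when two factors share one; so separability is checked on the
    generators, each of which is a root of a single factor. *)
Lemma galois_hull (F : fieldType) (M : closedFieldType)
    (iota : {rmorphism F -> M}) (rs : seq M) :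
  (forall x, x \in rs -> exists p : {poly F},
    separable_poly p /\ root (map_poly iota p) x) ->
  exists E : set M, finite_galois (range iota) E /\ forall x, x \in rs -> E x.
Proof.
move=> rsP.
have [ps [psep psr]] : exists ps : seq {poly F},
    (forall p, p \in ps -> separable_poly p) /\
    forall x, x \in rs -> exists2 p, p \in ps & root (map_poly iota p) x.
  elim: rs rsP => [|x rs IHrs] rsP; first by exists [::].
  have [y yrs|ps [psep psr]] := IHrs; first by apply: rsP; rewrite inE yrs orbT.
  have [|p [sp px]] := rsP x; first by rewrite inE eqxx.
  exists (p :: ps); split=> y; rewrite inE => /predU1P[->//|].
  - exact: psep.
  - by exists p; rewrite ?inE ?eqxx.
  - by move=> /psr[q qps qy]; exists q; rewrite // inE qps orbT.
pose P := \prod_(p <- ps) p.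
have P0 : P != 0.
  by rewrite prodf_seq_neq0; apply/allP => p /psep/separable_poly_neq0.
have rootP (M' : fieldType) (i : {rmorphism F -> M'}) x :
    root (map_poly i P) x -> exists2 p, p \in ps & root (map_poly i p) x.
  rewrite rmorph_prod /=; elim: ps {psep psr P P0} => [|p ps IHps].
    by rewrite big_nil (negPf (root1 x)).
  rewrite big_cons rootM => /orP[px|/IHps[q qps qx]].
    by exists p; rewrite ?inE ?eqxx.
  by exists q; rewrite ?inE ?qps ?orbT.
have rootP' x : x \in rs -> root (map_poly iota P) x.
  move=> /psr[p pps px]; rewrite rmorph_prod /= (big_rem p) //= rootM.
  by rewrite px.
have [r Pr] := closed_field_poly_normal (map_poly iota P).
have Pr' : map_poly iota P %= \prod_(z <- r) ('X - z%:P).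
  rewrite {1}Pr; apply: eqp_scale.
  by rewrite lead_coef_eq0 map_poly_eq0.
have rP x : (x \in r) = root (map_poly iota P) x.
  by rewrite (eqp_root Pr') root_prod_XsubC.
have [x|E [j [jA jr jmin]]] := @adjoin_seq_exists _ _ iota r.
  by rewrite rP => Px; exists P.
have [r0 r0E] : exists r0, map j r0 = r.
  elim: (r) jr => [|x s IHs] jr; first by exists [::].
  have [y ys|s0 <-] := IHs; first by apply: jr; rewrite inE ys orbT.
  have [|y <-] := jr x; first by rewrite inE eqxx.
  by exists (y :: s0).
have jin p : map_poly iota p = map_poly j (map_poly (in_alg E) p).
  by rewrite -map_poly_comp; apply: eq_map_poly => a; rewrite /= jA.
have gen : <<1 & r0>>%VS = {:E}%VS.
  apply/eqP; rewrite eqEsubv subvf /=; apply/subvP => v _.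
  (* This image is a subring containing [F] and all roots, so by [jmin] it exhausts [range j]. *)
  pose S := [set j w | w in [set w | w \in <<1 & r0>>%VS]].
  have [|_ [a _ <-]|x xr||w /= wr /fmorph_inj<- //] := jmin S _ _ _ (j v).
  - split.
    + by exists 1; rewrite ?rmorph1 //= mem1v.
    + move=> _ _ [x xr <-] [y yr <-]; exists (x - y); rewrite ?rmorphB //.
      exact: rpredB.
    + move=> _ _ [x xr <-] [y yr <-]; exists (x * y); rewrite ?rmorphM //.
      exact: rpredM.
  - by exists a%:A => //=; apply: rpredZ; exact: mem1v.
  - rewrite -r0E in xr; have /mapP[y yr ->] := xr.
    by exists y => //=; apply: seqv_sub_adjoin.
  - by exists v.
have axE : SplittingField.axiom E.
  exists (map_poly (in_alg E) P); first by apply/polyOver1P; exists P.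
  exists r0 => //; rewrite -(eqp_map j) -jin.
  by rewrite map_poly_prod_XsubC r0E.
pose E' : splittingFieldType F := HB.pack (FieldExt.sort E)
  (FieldExt_isSplittingField.Build F E axE).
exists (range j); split; last first.
  by move=> x /rootP'; rewrite -rP => /jr[y <-]; exists y.
apply: (@range_finite_galois F E' M iota j jA).
change (separable 1 {:E}%VS); rewrite -gen; apply: separable_Fadjoin_seq.
apply/allP => y yr; apply/separable_elementP.
have /rootP[p pps py] : root (map_poly (in_alg E) P) y.
  by rewrite -(fmorph_root j) -jin -rP -r0E map_f.
exists (map_poly (in_alg E) p); split=> //; first by apply/polyOver1P; exists p.
by rewrite separable_map psep.
Qed.

Lemma finite_galois_refl (F : fieldType) (B : set F) : is_subfield B ->
  finite_galois B B.
Proof.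
move=> Bfield; have [[B1 BB BM] BV] := Bfield; split=> //.
  exists [:: 1]; apply/seteqP; split=> [z Bz|_ [a Ba ->]].
    by exists (fun=> z) => //; rewrite big_ord1 mulr1.
  by rewrite big_ord1 mulr1.
move=> z Bz; exists ('X - z%:P); split.
- move=> i; rewrite coefB coefX coefC.
  have B0 : B 0 by rewrite -(subrr 1); exact: (BB).
  by apply: (BB); [case: eqP|case: ifP].
- by have := separable_prod_XsubC [:: z]; rewrite big_seq1.
- by rewrite root_XsubC.
- by exists [:: z]; rewrite big_seq1 eqpxx; split=> // a; rewrite inE => /eqP->.
Qed.

(** The Galois hull of the two spanning sequences together contains both extensions. It provides
    upper bounds for branch data at a single point. *)
Lemma galois_join (F : fieldType) (M : closedFieldType)
    (iota : {rmorphism F -> M}) (E E' : set M) :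
  finite_galois (range iota) E -> finite_galois (range iota) E' ->
  exists E'', [/\ finite_galois (range iota) E'', E `<=` E'' & E' `<=` E''].
Proof.
move=> [_ _ [s sE] En] [_ _ [s' s'E] E'n].
have gen (G : set M) (r : seq M) : G = [set z | exists2 a : nat -> M,
    (forall i, range iota (a i)) & z = \sum_(i < size r) a i * r`_i] ->
    forall z, z \in r -> G z.
  move=> -> z /(nthP 0)[i ir <-]; exists (fun l => if l == i then 1 else 0).
    by move=> l; case: ifP => _; [exists 1|exists 0]; rewrite ?rmorph1 ?rmorph0.
  rewrite (bigD1 (Ordinal ir)) //= eqxx mul1r big1 ?addr0 // => l.
  by rewrite -val_eqE /= => /negPf->; rewrite mul0r.
have sep (G : set M) : separable_normal (range iota) G -> forall z, G z ->
    exists p : {poly F}, separable_poly p /\ root (map_poly iota p) z.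
  move=> Gn z /Gn[_ [/coefs_in_range[p ->] psep pz _]].
  by exists p; rewrite -(separable_map iota).
have [z|E'' [E''gal E''s]] := @galois_hull _ _ iota (s ++ s').
  by rewrite mem_cat => /orP[/(gen _ _ sE)|/(gen _ _ s'E)]; exact: sep.
have [[E''ring _] iE'' _ _] := E''gal.
have span (r : seq M) : (forall z, z \in r -> E'' z) ->
  [set z | exists2 a : nat -> M,
    (forall i, range iota (a i)) & z = \sum_(i < size r) a i * r`_i] `<=` E''.
  move=> rE _ [a aF ->]; apply: mem_subring_sum => // i _.
  have [_ _ mulE] := E''ring; apply: mulE; first exact: iE''.
  exact/rE/mem_nth.
exists E''; split=> //.
  by rewrite sE; apply: span => z zs; apply: E''s; rewrite mem_cat zs.
by rewrite s'E; apply: span => z zs; apply: E''s; rewrite mem_cat zs orbT.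
Qed.

Section SubfieldType.
Variables (F : fieldType) (S : set F) (Sfield : is_subfield S).

Definition subfield_pred : pred F := fun z => `[< S z >].

Lemma subfield_divring_closed : divring_closed subfield_pred.
Proof.
have [[S1 SB SM] SV] := Sfield; split; first exact/asboolP.
  by move=> x y /asboolP Sx /asboolP Sy; apply/asboolP; exact: (SB).
by move=> x y /asboolP Sx /asboolP Sy; apply/asboolP; apply: (SM) => //; exact: (SV).
Qed.

HB.instance Definition _ :=
  GRing.isDivringClosed.Build F subfield_pred subfield_divring_closed.

Record subfield_carrier := SubfieldCarrier {
  subfield_val :> F; subfield_valP : subfield_val \in subfield_pred }.
HB.instance Definition _ := [isSub for subfield_val].
HB.instance Definition _ := [Choice of subfield_carrier by <:].
HB.instance Definition _ :=
  [SubChoice_isSubIntegralDomain of subfield_carrier by <:].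
HB.instance Definition _ :=
  [SubIntegralDomain_isSubField of subfield_carrier by <:].

(** Function fields are given as sets; a field type with the same elements is needed for polynomials
    over them and for ring morphisms out of them. *)
Lemma subfield_type : exists (E : fieldType) (i : {rmorphism E -> F}), range i = S.
Proof.
exists subfield_carrier, (val : {rmorphism subfield_carrier -> F}).
apply/seteqP; split=> [_ [[z Sz] _ <-]|z Sz]; first exact/asboolP.
by exists (SubfieldCarrier (asboolT Sz)).
Qed.

End SubfieldType.

(** * Fraction fields and simple extensions *)

Lemma fraction_div (R : idomainType) (z : {fraction R}) :
  exists ab : R * R, ab.2 != 0 /\
    z = FracField.tofrac ab.1 / FracField.tofrac ab.2.
Proof.
elim/quotW: z => x; exists (\n_x, \d_x); rewrite /= denom_ratioP; split=> //.
apply: (canRL (mulfK _)); first by rewrite tofrac_eq0 denom_ratioP.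
unlock FracField.tofrac; rewrite -[LHS]FracField.pi_mul.
rewrite /FracField.mulf !numden_Ratio ?oner_eq0 // mulr1.
apply/eqmodP; rewrite /= FracField.equivfE.
by rewrite !numden_Ratio ?mulf_neq0 ?denom_ratioP ?oner_eq0 // mulr1 mulrC.
Qed.

Lemma fraction_lift (R : idomainType) (E : fieldType) (r : {rmorphism R -> E}) :
  injective r ->
  exists j : {rmorphism {fraction R} -> E}, forall x, j (FracField.tofrac x) = r x.
Proof.
move=> r_inj; have /choice[ab abP] := @fraction_div R.
have r0 x : x != 0 -> r x != 0 by rewrite -(rmorph0 r) (inj_eq r_inj).
have f0 (x : R) : x != 0 -> FracField.tofrac x != 0 by rewrite tofrac_eq0.
pose j z := r (ab z).1 / r (ab z).2.
have jE x y : y != 0 -> j (FracField.tofrac x / FracField.tofrac y) = r x / r y.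
  move=> y0; have [d0 /eqP] := abP (FracField.tofrac x / FracField.tofrac y).
  rewrite /j; move: (ab _) d0 => -[n d] /= d0.
  rewrite eqr_div ?f0 // -!tofracM tofrac_eq => /eqP E'.
  by apply/eqP; rewrite eqr_div ?r0 // -!rmorphM E'.
have jF x : j (FracField.tofrac x) = r x.
  by rewrite -[FracField.tofrac x]divr1 -tofrac1 jE ?oner_eq0 // rmorph1 divr1.
have jzm : zmod_morphism j.
  move=> x y; have [d0 xE] := abP x; have [e0 yE] := abP y.
  move: (ab x) (ab y) d0 e0 xE yE => -[n d] [m e] /= d0 e0 -> ->.
  rewrite -mulNr addf_div ?f0 // -!tofracM -tofracN -!tofracM -!tofracD.
  by rewrite !jE ?mulf_neq0 // -mulNr addf_div ?r0 // !(rmorphM, rmorphD, rmorphN).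
have jmm : monoid_morphism j.
  split=> [|x y]; first by rewrite -tofrac1 jF rmorph1.
  have [d0 xE] := abP x; have [e0 yE] := abP y.
  move: (ab x) (ab y) d0 e0 xE yE => -[n d] [m e] /= d0 e0 -> ->.
  rewrite mulf_div -!tofracM.
  by rewrite !jE ?mulf_neq0 // mulf_div !rmorphM.
pose jM : {rmorphism {fraction R} -> E} := HB.pack j
  (GRing.isZmodMorphism.Build _ _ j jzm) (GRing.isMonoidMorphism.Build _ _ j jmm).
by exists jM.
Qed.

(** Send [t] to a root [tau] in [M] of its minimal polynomial [m]. The polynomial chosen to
    represent an element is irrelevant, since every polynomial vanishing at [t] is a multiple of [m]
    and so vanishes at [tau]. *)
Lemma simple_embedding (F E : fieldType) (M : closedFieldType)
    (j : {rmorphism F -> E}) (i : {rmorphism F -> M}) (t : E) :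
  algebraicOver j t -> (forall z, exists q, z = (map_poly j q).[t]) ->
  exists phi : {rmorphism E -> M}, forall a, phi (j a) = i a.
Proof.
move=> /min_poly_exists[m [m0 mt mmin]] /choice[q qE].
have m_dvd p : root (map_poly j p) t -> m %| p.
  move=> pt; rewrite /dvdp; apply: contraT => r0.
  suff /mmin/(_ r0) : root (map_poly j (p %% m)) t by rewrite leqNgt ltn_modp m0.
  move: pt; rewrite {1}(divp_eq p m) rmorphD rmorphM /= /root hornerD hornerM.
  by rewrite (rootP mt) mulr0 add0r.
have [tau mtau] : exists tau, root (map_poly i m) tau.
  apply: closed_rootP => //; rewrite size_map_poly neq_ltn.
  by rewrite -(size_map_poly j) (root_size_gt1 _ mt) ?map_poly_eq0 ?orbT.
pose phi z := (map_poly i (q z)).[tau].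
have phiE p : phi (map_poly j p).[t] = (map_poly i p).[tau].
  apply/eqP; rewrite -subr_eq0 /phi -hornerN -hornerD -rmorphN -rmorphD /=.
  have /m_dvd/dvdpP[u ->] : root (map_poly j (q (map_poly j p).[t] - p)) t.
    by rewrite /root rmorphB hornerD hornerN -qE subrr.
  by rewrite rmorphM hornerM (rootP mtau) mulr0.
have phizm : zmod_morphism phi.
  move=> x y; rewrite {1}(qE x) {1}(qE y) -hornerN -hornerD -rmorphB phiE.
  by rewrite rmorphB hornerD hornerN.
have phimm : monoid_morphism phi.
  split=> [|x y]; last first.
    by rewrite {1}(qE x) {1}(qE y) -hornerM -rmorphM phiE rmorphM hornerM.
  by have := phiE 1; rewrite !rmorph1 !hornerC.
pose phiM : {rmorphism E -> M} := HB.pack phi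
  (GRing.isZmodMorphism.Build _ _ phi phizm)
  (GRing.isMonoidMorphism.Build _ _ phi phimm).
exists phiM => a; rewrite -[LHS]/(phi (j a)) -(hornerC (j a) t) -map_polyC phiE.
by rewrite map_polyC hornerC.
Qed.

Lemma poly_split_const (R : comNzRingType) (p : {poly R}) :
  exists q, p = q * 'X + (p.[0])%:P.
Proof.
have /factor_theorem[q pE] : root (p - (p.[0])%:P) 0.
  by rewrite /root hornerD hornerN hornerC subrr.
by exists q; move: pE; rewrite subr0 => <-; rewrite subrK.
Qed.

(** Write the minimal polynomial of [z], the value of [q] at [t], as [p1 * 'X + p.[0]]. Minimality
    forces [p.[0] != 0], so the inverse of [z] is [- p1(z) / p.[0]], a polynomial in [t]. *)
Lemma inv_in_adjoin (F E : fieldType) (j : {rmorphism F -> E}) (t : E) q :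
  algebraicOver j t -> exists r, (map_poly j q).[t]^-1 = (map_poly j r).[t].
Proof.
move=> alg_t; set z := (map_poly j q).[t].
have [z0|z0] := eqVneq z 0; first by exists 0; rewrite z0 invr0 rmorph0 horner0.
have alg_z : algebraicOver j z.
  apply/integral_algebraic; apply: integral_horner; last exact/integral_algebraic.
  by apply/integral_poly => i; rewrite coef_map; exact: integral_id.
have [p [p0 pz pmin]] := min_poly_exists alg_z.
have [p1 pE] := poly_split_const p.
have p1z : (map_poly j p1).[z] * z = - j p.[0].
  move: pz; rewrite {1}pE /root rmorphD rmorphM /= map_polyX map_polyC.
  by rewrite hornerD hornerM hornerX hornerC addr_eq0 => /eqP.
have pa0 : p.[0] != 0.
  apply/eqP => p00; rewrite p00 addr0 in pE.
  have p10 : p1 != 0 by apply: contraNneq p0; rewrite pE => ->; rewrite mul0r.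
  have /pmin/(_ p10) : root (map_poly j p1) z.
    apply/eqP; apply: (mulIf z0); rewrite p1z p00 rmorph0 oppr0 mul0r //.
  by rewrite pE size_mulX // ltnn.
exists (- (p.[0])^-1 *: (p1 \Po q)).
rewrite map_polyZ hornerZ map_comp_poly horner_comp -/z; apply: (mulIf z0).
rewrite mulVf // -mulrA p1z rmorphN fmorphV mulrNN mulVf // fmorph_eq0 //.
Qed.

(** * Discrete valuation rings *)

Section DvrValuation.
Variables (F : fieldType) (O : dvr F).
Implicit Types (x y z t u : F) (m n : nat).

Lemma maxidE : maxid O = maxid_pow O 1.
Proof.
have [t tU] := dvr_uniformizer O.
by rewrite (maxid_uniformizer tU) (maxid_powE _ tU) expr1.
Qed.

Lemma maxid_sub x : maxid O x -> O x. Proof. by case. Qed.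

Lemma maxid0 : maxid O 0. Proof. by rewrite maxidE; exact: maxid_pow0. Qed.

Lemma maxidM x y : O x -> maxid O y -> maxid O (x * y).
Proof. by rewrite maxidE; exact: maxid_powM. Qed.

Lemma maxidMr x y : O y -> maxid O x -> maxid O (x * y).
Proof. by rewrite mulrC; exact: maxidM. Qed.

Lemma maxidB x y : maxid O x -> maxid O y -> maxid O (x - y).
Proof. by rewrite maxidE; exact: maxid_powB. Qed.

Lemma maxidD x y : maxid O x -> maxid O y -> maxid O (x + y).
Proof. by rewrite maxidE; exact: maxid_powD. Qed.

Lemma maxid1 : ~ maxid O 1.
Proof.
by case=> _ []; [apply/eqP; exact: oner_neq0|rewrite invr1; apply; exact: dvr1].
Qed.

Lemma notin_maxid x : O x -> ~ maxid O x -> x != 0 /\ O x^-1.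
Proof.
move=> Ox nx; split; first by apply/eqP => x0; apply: nx; rewrite x0; exact: maxid0.
by apply: contrapT => nxV; apply: nx; split=> //; right.
Qed.

Lemma maxid_inv x : maxid O x -> O x^-1 -> x = 0.
Proof. by case=> _ []. Qed.

Lemma unit_1Dmaxid x : maxid O x -> 1 + x != 0 /\ O (1 + x)^-1.
Proof.
move=> mx; apply: notin_maxid; first exact/dvrD/maxid_sub/mx/dvr1.
by move=> /maxidB/(_ mx); rewrite addrK; exact: maxid1.
Qed.

Lemma maxid_sum I (r : seq I) (P : pred I) (f : I -> F) :
  (forall i, P i -> maxid O (f i)) -> maxid O (\sum_(i <- r | P i) f i).
Proof. by move=> mf; elim/big_ind: _ => //; [exact: maxid0|exact: maxidD]. Qed.

Lemma maxid_prime x y : O x -> O y -> maxid O (x * y) -> maxid O x \/ maxid O y.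
Proof.
move=> Ox Oy mxy; have [|nx] := pselect (maxid O x); [by left|right].
have [x0 Ox'] := notin_maxid Ox nx.
by rewrite -[y](mulKf x0); exact: maxidM.
Qed.

Lemma uniformizer_maxid t : uniformizer O t -> maxid O t.
Proof. by move=> [Ot t0 tV _]; split=> //; right. Qed.

Lemma uniformizer_decomp t z : uniformizer O t -> O z -> z != 0 ->
  exists n u, [/\ u != 0, O u, O u^-1 & z = u * t ^+ n].
Proof.
move=> [_ _ _ tP] Oz z0; have [n [u [Ou OuV zE]]] := tP z Oz z0.
by exists n, u; split=> //; apply: contraNneq z0; rewrite zE => ->; rewrite mul0r.
Qed.

(** The valuation is never defined as a function: this equivalence turns membership in powers of the
    maximal ideal into comparison of exponents. *)
Lemma maxid_pow_unit t m n u : uniformizer O t -> u != 0 -> O u -> O u^-1 ->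
  maxid_pow O m (u * t ^+ n) <-> (m <= n)%N.
Proof.
move=> tU u0 Ou OuV; have [Ot t0 _ _] := tU.
rewrite (maxid_powE _ tU); split=> [[a [Oa E]]|mn].
  rewrite leqNgt; apply/negP => nm.
  have E1 : 1 = u^-1 * a * t ^+ (m - n.+1) * t.
    apply: (mulfI u0); rewrite mulr1 -!mulrA mulVKf // -exprSr.
    apply: (mulIf (expf_neq0 n t0)); rewrite E -mulrA -exprD.
    by congr (_ * _ ^+ _); rewrite addSn -addnS subnK.
  apply: maxid1; rewrite E1; apply: maxidM; last exact: uniformizer_maxid.
  exact/dvrM/dvrX/Ot/dvrM.
exists (u * t ^+ (n - m)); split; first exact/dvrM/dvrX.
by rewrite -mulrA -exprD subnK.
Qed.

Lemma maxid_powXM m n x y :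
  maxid_pow O m x -> maxid_pow O n y -> maxid_pow O (m + n) (x * y).
Proof.
have [t tU] := dvr_uniformizer O; rewrite !(maxid_powE _ tU).
case=> a [Oa ->] [b [Ob ->]]; exists (a * b); split; first exact: dvrM.
by rewrite mulrACA exprD.
Qed.

Lemma maxid_powX n x : maxid O x -> maxid_pow O n (x ^+ n).
Proof. by move=> mx; exists 1, x; split=> //; [exact: dvr1|rewrite mul1r]. Qed.

Lemma fractions_dvr x : O x -> fractions O x.
Proof. by move=> Ox; exists x, 1; rewrite divr1; split=> //; exact: dvr1. Qed.

Lemma fractions_valuation z : fractions O z -> ~ O z -> maxid O z^-1.
Proof.
have [t tU] := dvr_uniformizer O; have [Ot t0 _ _] := tU.
case=> a [b [Oa Ob ->]] nz.
have [a0|a0] := eqVneq a 0; first by case: nz; rewrite a0 mul0r; exact: dvr0.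
have [b0|b0] := eqVneq b 0; first by case: nz; rewrite b0 invr0 mulr0; exact: dvr0.
have [m [u [u0 Ou OuV aE]]] := uniformizer_decomp tU Oa a0.
have [n [v [v0 Ov OvV bE]]] := uniformizer_decomp tU Ob b0.
rewrite invf_div; have [nm|mn] := leqP n m.
  case: nz; rewrite aE bE -(subnK nm) exprD mulrA -mulf_div divff ?expf_neq0 //.
  by rewrite mulr1 mulrAC; exact/dvrM/dvrX/Ot/dvrM.
rewrite aE bE -(subnK mn) exprD exprS.
rewrite (_ : _ / _ = v * t ^+ (n - m.+1) * u^-1 * t).
  by apply: maxidM; [exact/dvrM/OuV/dvrM/dvrX|exact: uniformizer_maxid].
by field; rewrite u0 expf_neq0.
Qed.

(** The pole order of [w] is at most the valuation [n] of its denominator, so the powers of [z] from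
    [n.+1] on outweigh it. *)
Lemma maxid_expr_absorb z w : maxid O z -> fractions O w ->
  exists r0, forall r, (r0 <= r)%N -> maxid O (z ^+ r * w).
Proof.
have [t tU] := dvr_uniformizer O; have [Ot t0 _ _] := tU.
move=> mz [a [b [Oa Ob ->]]].
have [b0|b0] := eqVneq b 0.
  by exists 0%N => r _; rewrite b0 invr0 !mulr0; exact: maxid0.
have [n [v [v0 Ov OvV bE]]] := uniformizer_decomp tU Ob b0.
exists n.+1 => r nr; have : maxid_pow O n.+1 (z ^+ r).
  by apply: maxid_pow_le nr _ _; exact: maxid_powX.
rewrite (maxid_powE _ tU) => -[d [Od ->]]; rewrite bE.
rewrite (_ : _ * _ = d * a * v^-1 * t); last first.
  by rewrite exprS; field; rewrite v0 expf_neq0.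
by apply: maxidM; [exact/dvrM/OvV/dvrM|exact: uniformizer_maxid].
Qed.

End DvrValuation.

Lemma fractions_nonzero_denominator (F : fieldType) (O : dvr F) z :
  fractions O z -> exists a b, [/\ O a, O b, b != 0 & z = a / b].
Proof.
move=> [a [b [Oa Ob ->]]]; have [->|b0] := eqVneq b 0; last by exists a, b.
exists 0, 1; rewrite oner_eq0 invr0 mulr0 mul0r.
by split=> //; [exact: dvr0|exact: dvr1].
Qed.

(** * Approximation for pairwise incomparable discrete valuation rings *)

Section Approximation.
Variables (F : fieldType) (K : set F).

(** An element of [O'] outside [O] has negative valuation for [O], so multiplying it by an element
    of [O] gives [t^-1]. Then [O'] contains [O] and [t^-1], hence all of [K], and its uniformizer
    would be invertible. *)
Lemma dvr_maximal (O O' : dvr F) : fractions O = K -> fractions O' = K ->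
  O `<=` O' -> O' `<=` O.
Proof.
move=> OK O'K OO' z O'z; apply: contrapT => nz.
have [t tU] := dvr_uniformizer O; have [Ot t0 _ _] := tU.
have Kz : K z by rewrite -O'K; exact: fractions_dvr.
have mz : maxid O z^-1 by apply: fractions_valuation => //; rewrite OK.
have z0 : z != 0 by apply: contra_notN nz => /eqP->; exact: dvr0.
have [n [u [u0 Ou OuV zE]]] := uniformizer_decomp tU (maxid_sub mz) (invr_neq0 z0).
have O'tV : O' t^-1.
  case: n zE => [|n] zE.
    by case: nz; rewrite -[z]invrK zE expr0 mulr1.
  rewrite (_ : t^-1 = t ^+ n * u * z).
    by apply: dvrM => //; apply: OO'; apply: dvrM => //; exact: dvrX.
  by rewrite -[z]invrK zE exprS; field; rewrite u0 t0 expf_neq0.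
have [t' [O't' t'0 nt' _]] := dvr_uniformizer O'; apply: nt'.
have : K t'^-1.
  by rewrite -O'K; exists 1, t'; rewrite mul1r; split=> //; exact: dvr1.
rewrite -OK => -[a [b [Oa Ob ->]]].
have [->|b0] := eqVneq b 0; first by rewrite invr0 mulr0; exact: dvr0.
have [m [v [v0 Ov OvV ->]]] := uniformizer_decomp tU Ob b0.
rewrite invfM -exprVn; apply: dvrM; first exact: OO'.
by apply: dvrM; [exact: OO'|exact: dvrX].
Qed.

Lemma maxid_expr_absorb_family (X : nat -> dvr F) n (P : pred nat) z w :
  (forall j, (j < n)%N -> P j -> maxid (X j) z /\ fractions (X j) w) ->
  exists r, forall j, (j < n)%N -> P j -> maxid (X j) (z ^+ r.+1 * w).
Proof.
elim: n => [|n IHn] zw; first by exists 0%N.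
have [r rP] := IHn (fun j jn => zw j (ltnW jn)).
have [Pn|nPn] := boolP (P n); last first.
  exists r => j; rewrite ltnS leq_eqVlt => /predU1P[->|]; last exact: rP.
  by rewrite (negPf nPn).
have [mz fw] := zw n (ltnSn n) Pn.
have [r0 r0P] := maxid_expr_absorb mz fw.
exists (r + r0)%N => j; rewrite ltnS leq_eqVlt => /predU1P[->|jn] Pj.
  by apply: r0P; rewrite -addSn leq_addl.
rewrite -addSn exprD mulrAC; apply: maxidMr; last exact: rP.
by apply: dvrX; apply: maxid_sub; case: (zw j (ltnW jn) Pj).
Qed.

Variable X : nat -> dvr F.
Hypothesis XK : forall i, fractions (X i) = K.
Hypothesis Xneq : forall i j, X i `<=` X j -> i = j.

(** Induction on [n]. Let [z] serve for the rings before [n], and let [w = b / a] have a pole at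
    [X i] and a zero at [X n]. For [r] large, [z ^+ r.+1 * w] vanishes at the earlier rings other
    than [X i]. It works if [z] is regular at [X n]. If [z] has a pole there, divide by
    [1 + z ^+ r.+1]: then [z ^+ r.+1 / (1 + z ^+ r.+1)] is a unit at [X i] and [X n], and at the
    earlier rings the denominator is a unit. *)
Lemma pole_at_one i n : exists z, [/\ K z, ~ X i z
  & forall j, (j < n)%N -> j != i -> maxid (X j) z].
Proof.
have KM x y : K x -> K y -> K (x * y).
  rewrite -(XK i) => -[a [b [Oa Ob ->]]] [d [e [Od Oe ->]]].
  by exists (a * d), (b * e); rewrite mulf_div; split=> //; exact: dvrM.
have KV x : K x -> K x^-1.
  by rewrite -(XK i) => -[a [b [Oa Ob ->]]]; exists b, a; rewrite invf_div.
have KD1 x : K x -> K (1 + x).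
  rewrite -(XK i) => -[a [b [Oa Ob ->]]].
  have [->|b0] := eqVneq b 0.
    by rewrite invr0 mulr0 addr0; apply: fractions_dvr; exact: dvr1.
  exists (b + a), b; rewrite mulrDl divff //; split=> //; exact: dvrD.
elim: n => [|n [z [Kz nz zP]]].
  have [t [Ot t0 nt _]] := dvr_uniformizer (X i).
  exists t^-1; split=> //; rewrite -(XK i); exists 1, t.
  by rewrite mul1r; split=> //; exact: dvr1.
have extend y : K y -> ~ X i y -> maxid (X n) y \/ n = i ->
    (forall j, (j < n)%N -> j != i -> maxid (X j) y) ->
    exists y, [/\ K y, ~ X i y & forall j, (j < n.+1)%N -> j != i -> maxid (X j) y].
  move=> Ky ny yn yP; exists y; split=> // j.
  rewrite ltnS leq_eqVlt => /predU1P[->|]; last exact: yP.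
  by case: yn => [//|->]; rewrite eqxx.
have [ni|ni] := eqVneq n i; first by apply: (extend z) => //; right.
have [mz|nmz] := pselect (maxid (X n) z); first by apply: (extend z) => //; left.
have notsub k l : k != l -> exists2 a, X k a & ~ X l a.
  move=> kl; apply: contrapT => nex; move/eqP: kl; apply; apply: Xneq => a ka.
  by apply: contrapT => la; apply: nex; exists a.
have [|a ia na] := notsub i n; first by rewrite eq_sym.
have [b nb ib] := notsub n i ni.
have a0 : a != 0 by apply: contra_notN na => /eqP->; exact: dvr0.
have Ka : K a by rewrite -(XK i); exact: fractions_dvr.
have Kb : K b by rewrite -(XK n); exact: fractions_dvr.
have Kw : K (b / a) by apply: KM => //; exact: KV.
have iw : ~ X i (b / a) by move=> /dvrM/(_ ia); rewrite divfK.
have nw : maxid (X n) (b / a).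
  by apply: maxidM => //; apply: fractions_valuation; rewrite ?XK.
have [j jn ji|r rP] := @maxid_expr_absorb_family X n (predC1 i) z (b / a).
  by rewrite XK; split=> //; exact: zP.
set w := b / a in Kw iw nw rP.
have KX m : K (z ^+ m).
  elim: m => [|m IHm]; last by rewrite exprS; exact: KM.
  by rewrite -(XK i) expr0; apply: fractions_dvr; exact: dvr1.
have z0 : z != 0 by apply: contra_notN nz => /eqP->; exact: dvr0.
have zX0 : z ^+ r.+1 != 0 by rewrite expf_neq0.
have iz : maxid (X i) (z ^+ r.+1)^-1.
  rewrite -exprVn exprS; apply: maxidMr.
    by apply: dvrX; apply: maxid_sub; apply: fractions_valuation; rewrite ?XK.
  by apply: fractions_valuation; rewrite ?XK.
have [nz'|nnz] := pselect (X n z).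
  apply: (extend (z ^+ r.+1 * w)); [exact: (KM)| |left|exact: rP].
    move=> iy; apply: iw; rewrite -[w](mulKf zX0).
    by apply: dvrM => //; exact: maxid_sub.
  by apply: maxidM => //; exact: dvrX.
have [i10 _] := unit_1Dmaxid iz.
have z10 : 1 + z ^+ r.+1 != 0.
  rewrite (_ : _ + _ = z ^+ r.+1 * (1 + (z ^+ r.+1)^-1)) ?mulf_neq0 //.
  by rewrite mulrDr divff // mulr1 addrC.
apply: (extend (z ^+ r.+1 * w / (1 + z ^+ r.+1))).
- by apply: (KM); [exact: (KM)|apply: KV; exact: KD1].
- move=> iy; apply: iw.
  rewrite (_ : w = z ^+ r.+1 * w / (1 + z ^+ r.+1) * (1 + (z ^+ r.+1)^-1)).
    by apply: dvrM => //; apply: dvrD; [exact: dvr1|exact: maxid_sub].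
  by field; rewrite zX0 z10.
- left; have nzV : maxid (X n) (z ^+ r.+1)^-1.
    rewrite -exprVn exprS; apply: maxidMr.
      by apply: dvrX; apply: maxid_sub; apply: fractions_valuation; rewrite ?XK.
    by apply: fractions_valuation; rewrite ?XK.
  have [n10 n1] := unit_1Dmaxid nzV.
  rewrite (_ : _ / _ = w * (1 + (z ^+ r.+1)^-1)^-1); first exact: maxidMr.
  by field; rewrite zX0 /= ?(addrC _ 1) ?z10.
- move=> j jn ji; apply: maxidMr; last exact: rP.
  suff /unit_1Dmaxid[] : maxid (X j) (z ^+ r.+1) by [].
  rewrite exprS; apply: maxidMr; last exact: zP.
  by apply: dvrX; apply: maxid_sub; exact: zP.
Qed.

(** For [z] as in [pole_at_one], the element [z / (1 + z)] is congruent to [1] at [X i] and to [0]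
    at the other rings. *)
Lemma unit_at_one i n : exists e, [/\ K e, X i e, ~ maxid (X i) e
  & forall j, (j < n)%N -> j != i -> maxid (X j) e].
Proof.
have [z [Kz nz zP]] := pole_at_one i n.
have z0 : z != 0 by apply: contra_notN nz => /eqP->; exact: dvr0.
have mz : maxid (X i) z^-1 by apply: fractions_valuation; rewrite ?XK.
have [i10 i1] := unit_1Dmaxid mz.
exists (1 + z^-1)^-1; split=> //.
- by rewrite -(XK i); exact: fractions_dvr.
- move=> /maxid_inv; rewrite invrK => /(_ (dvrD (dvr1 _) (maxid_sub mz))).
  by move/eqP; rewrite invr_eq0 (negPf i10).
- move=> j jn ji; have mjz := zP j jn ji; have [j10 j1] := unit_1Dmaxid mjz.
  rewrite (_ : _^-1 = (1 + z)^-1 * z); first exact: maxidM.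
  by field; rewrite z0 /= ?(addrC _ 1) ?j10.
Qed.

End Approximation.

(** * Algebraic dependence and residue fields *)

Lemma common_denominator (R : idomainType) (a : nat -> {fraction R}) n :
  exists d (b : nat -> R), d != 0 /\ forall i, (i < n)%N ->
    FracField.tofrac d * a i = FracField.tofrac (b i).
Proof.
elim: n => [|n [d [b [d0 db]]]]; first by exists 1, (fun=> 0); rewrite oner_eq0.
have [[x y] [/= y0 aE]] := fraction_div (a n).
exists (d * y), (fun i => if (i < n)%N then y * b i else d * x).
split=> [|i]; first exact: mulf_neq0.
rewrite ltnS leq_eqVlt => /predU1P[->|i_n].
  by rewrite ltnn aE !tofracM mulrACA divff ?mulr1 // tofrac_eq0.
by rewrite i_n !tofracM -db // mulrCA mulrA.
Qed.

Section AlgebraicDependence.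
Variables (k : closedFieldType) (Om : fieldType) (c : {rmorphism k -> Om}).
Implicit Types (s t u z : Om).

Lemma algebraic_over_closed z : algebraicOver c z -> range c z.
Proof.
case=> p p0 pz; have [r pE] := closed_field_poly_normal p; move: pz.
rewrite pE map_polyZ map_poly_prod_XsubC /root hornerZ mulf_eq0.
rewrite fmorph_eq0 lead_coef_eq0 (negPf p0) /= => pz.
have : root (\prod_(a <- map c r) ('X - a%:P)) z by [].
by rewrite root_prod_XsubC => /mapP[a _ ->]; exists a.
Qed.

Definition eval_at s : {poly k} -> Om := horner_eval s \o map_poly c.
HB.instance Definition _ s := GRing.RMorphism.on (eval_at s).

(** A two-variable relation has the shape of [coord_trdeg_le1] and is symmetric in [s] and [z]. For
    [s] transcendental over [k] it amounts to [z] being algebraic over [k(s)], as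
    [algebraicOver_frac_eval] shows. *)
Definition algdep s z := exists2 P : {poly {poly k}}, P != 0 &
  (map_poly (eval_at s) P).[z] = 0.

Lemma algdep_sym s z : algdep s z -> algdep z s.
Proof.
have evE x y (P : {poly {poly k}}) : (map_poly (eval_at x) P).[y]
    = (map_poly (map_poly c) P).[y%:P].[x].
  rewrite -[RHS]horner2_swapXY horner_swapXY -map_poly_comp.
  by congr (_.[_]); apply: eq_map_poly.
case=> P P0 PE; exists (swapXY P); first by rewrite swapXY_eq0.
by rewrite evE -swapXY_map horner2_swapXY -evE.
Qed.

Lemma eval_at_inj s : ~ algebraicOver c s -> injective (eval_at s).
Proof.
move=> ns; apply: raddf_inj => p ps; apply/eqP; apply: contra_notT ns => p0.
by exists p => //; apply/rootP.
Qed.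

(* an extension of [eval_at s] to the field [k(X)]; it exists only for [s]
   transcendental over [k], and identifies [k(X)] with [k(s)] *)
Definition frac_eval s (h : {rmorphism {fraction {poly k}} -> Om}) : Prop :=
  forall q, h (FracField.tofrac q) = eval_at s q.

Lemma frac_eval_exists s : ~ algebraicOver c s -> exists h, frac_eval s h.
Proof. by move=> /eval_at_inj/fraction_lift. Qed.

Lemma algebraicOver_frac_eval s h z : frac_eval s h ->
  algebraicOver h z <-> algdep s z.
Proof.
move=> hs; split=> [[p p0 pz]|[P P0 Pz]]; last first.
  exists (map_poly (@FracField.tofrac _) P).
    by rewrite map_poly_eq0_id0 // tofrac_eq0 lead_coef_eq0.
  rewrite -map_poly_comp /root; apply/eqP; rewrite -Pz.
  by congr (_.[_]); apply: eq_map_poly => q; exact: hs.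
have [d [b [d0 db]]] := common_denominator (fun i => p`_i) (size p).
have bE : map_poly (@FracField.tofrac _) (\poly_(i < size p) b i)
    = FracField.tofrac d *: p.
  apply/polyP => i; rewrite coef_map coefZ coef_poly.
  case: ltnP => ip; first exact/esym/db.
  by rewrite raddf0 nth_default ?mulr0.
exists (\poly_(i < size p) b i).
  apply/eqP => b0; move/eqP: bE; rewrite b0 rmorph0 eq_sym scaler_eq0.
  by rewrite tofrac_eq0 (negPf d0) (negPf p0).
have -> : map_poly (eval_at s) (\poly_(i < size p) b i)
    = map_poly h (map_poly (@FracField.tofrac _) (\poly_(i < size p) b i)).
  by rewrite -map_poly_comp; apply: eq_map_poly => q; rewrite /= hs.
by rewrite bE map_polyZ hornerZ (rootP pz) mulr0.
Qed.

(** Over a field algebraic means integral. The coefficients in [k(s)] of an equation of [z] are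
    quotients of polynomials in [s], hence integral over [k(t)], and a root of a polynomial with
    integral coefficients is integral. *)
Lemma frac_eval_algebraic_trans s t hs ht z : frac_eval s hs -> frac_eval t ht ->
  algebraicOver ht s -> algebraicOver hs z -> algebraicOver ht z.
Proof.
move=> hsP htP /integral_algebraic alg_s [p p0 pz].
have alg_poly q : integralOver ht (eval_at s q).
  apply: integral_horner alg_s; apply/integral_poly => i; rewrite coef_map.
  rewrite [X in integralOver _ X](_ : _ = ht (FracField.tofrac (q`_i)%:P)).
    exact: integral_id.
  by rewrite htP /eval_at /= /horner_eval map_polyC hornerC.
apply/integral_algebraic; apply: integral_root pz _; first by rewrite map_poly_eq0.
apply/integral_poly => i; rewrite coef_map.
have [[x y] [/= y0 ->]] := fraction_div p`_i.
by rewrite fmorph_div /= !hsP; apply: integral_div.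
Qed.

Section Residue.
Variables (O : dvr Om) (s : Om) (h : {rmorphism {fraction {poly k}} -> Om}).
Hypotheses (cO : range c `<=` O) (hP : frac_eval s h).
Hypothesis algO : forall z, O z -> algebraicOver h z.

Lemma const_unit a : maxid O (c a) -> a = 0.
Proof.
move=> ma; apply/eqP; rewrite -(fmorph_eq0 c); apply/eqP; apply: maxid_inv ma _.
by apply: cO; exists a^-1; rewrite ?fmorphV.
Qed.

Lemma eval_at_dvr u q : O u -> O (eval_at u q).
Proof.
move=> Ou; apply: mem_subring_horner => //; first exact: dvr_subring.
by move=> i; apply: cO; rewrite coef_map; exists q`_i.
Qed.

(** [q] splits into linear factors over [k]. The maximal ideal is prime and the leading coefficient
    is a unit, so one of the factors at [u] lies in the ideal. *)
Lemma eval_at_maxid u q : O u -> q != 0 -> maxid O (eval_at u q) ->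
  exists a, maxid O (u - c a).
Proof.
move=> Ou q0; have [r qE] := closed_field_poly_normal q; rewrite qE.
rewrite /eval_at /= /horner_eval map_polyZ hornerZ => /maxid_prime[||/const_unit|].
- by apply: cO; exists (lead_coef q).
- by rewrite -[_.[_]]/(eval_at u _); exact: eval_at_dvr.
- by move/eqP; rewrite lead_coef_eq0 (negPf q0).
rewrite map_poly_prod_XsubC; elim: r {q0 qE} => [|a r IHr].
  by rewrite /= big_nil hornerC => /maxid1.
rewrite /= big_cons hornerM hornerXsubC => /maxid_prime[||ma|//].
- by apply: dvrB => //; apply: cO; exists a.
- rewrite -map_poly_prod_XsubC -[_.[_]]/(eval_at u _); exact: eval_at_dvr.
- by exists a.
Qed.

(** The uniformizer [t] is transcendental over [k], since a nonzero constant is a unit, and [u] is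
    algebraic over [k(t)]. Take a relation between [u] and [t] and divide it by the largest power of
    the variable of [t]. Reducing modulo [t] leaves a nonzero polynomial over [k] whose value at [u]
    is in the maximal ideal. *)
Lemma residue_exists u : O u -> exists a, maxid O (u - c a).
Proof.
move=> Ou; have [t tU] := dvr_uniformizer O; have [Ot t0 nt _] := tU.
have mt := uniformizer_maxid tU.
have trans_t : ~ algebraicOver c t.
  move=> /algebraic_over_closed[a _ aE]; case: nt; rewrite -aE -fmorphV.
  by apply: cO; exists a^-1.
have [ht htP] := frac_eval_exists trans_t.
(* Everything in [O] is algebraic over [k(s)]. In particular [t] is, so by symmetry [s] is algebraic
   over [k(t)], and algebraicity passes from [k(s)] to [k(t)]. *)
have alg_u : algebraicOver ht u.
  apply: (frac_eval_algebraic_trans hP htP) (algO Ou).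
  apply/(algebraicOver_frac_eval s htP)/algdep_sym.
  exact/(algebraicOver_frac_eval t hP)/algO.
have /algdep_sym[P P0 Pt] := (algebraicOver_frac_eval u htP).1 alg_u.
have [m [Q]] := multiplicity_XsubC P 0; rewrite P0 /= subr0 => Q0 PE.
have Qt : (map_poly (eval_at u) Q).[t] = 0.
  move/eqP: Pt; rewrite PE rmorphM rmorphXn /= map_polyX hornerM hornerXn.
  by rewrite mulf_eq0 expf_eq0 (negPf t0) andbF orbF => /eqP.
apply: (@eval_at_maxid u Q.[0]) => //.
have [q1 QE] := poly_split_const Q.
move: Qt; rewrite {1}QE rmorphD rmorphM /= map_polyX map_polyC hornerD hornerM.
rewrite hornerX hornerC => /eqP; rewrite addrC addr_eq0 => /eqP ->.
rewrite -mulNr; apply: maxidM => //; apply: dvrN.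
apply: mem_subring_horner => //; first exact: dvr_subring.
by move=> i; rewrite coef_map; exact: eval_at_dvr.
Qed.

End Residue.
End AlgebraicDependence.

(** * Finiteness of the punctures *)

(** Removes the largest common power of ['X]. With the family read as one polynomial in two
    variables, that power is the multiplicity of the root [0] after the variables are swapped. *)
Lemma strip_powers (R : idomainType) (b : nat -> {poly R}) n :
  (exists2 i, (i < n)%N & b i != 0) ->
  exists m (b' : nat -> {poly R}),
    (forall i, (i < n)%N -> b i = b' i * 'X^m) /\
    exists2 i, (i < n)%N & (b' i).[0] != 0.
Proof.
move=> [i0 i0n b0]; pose P := \poly_(i < n) b i.
have P0 : swapXY P != 0.
  rewrite swapXY_eq0; apply: contra_neq b0 => /(congr1 (coefp i0)).
  by rewrite /coefp coef_poly i0n coef0.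
have [m [Q]] := multiplicity_XsubC (swapXY P) 0; rewrite P0 /= subr0 => Q0 PE.
have PE' : P = swapXY Q * ('X^m)%:P.
  by rewrite -[P]swapXYK PE rmorphM rmorphXn /= swapXY_X -rmorphXn.
exists m, (fun i => (swapXY Q)`_i); split=> [i i_n|].
  by rewrite -coefMC -PE' coef_poly i_n.
have [i iQ] : exists i, Q.[0]`_i != 0.
  by exists (size Q.[0]).-1; rewrite -[_`__]/(lead_coef _) lead_coef_eq0.
have iQ' : ((swapXY Q)`_i).[0] = Q.[0]`_i.
  by rewrite !horner_coef0 coef_swapXY.
exists i; last by rewrite iQ'.
rewrite ltnNge; apply: contra iQ => ni.
have : P`_i = 0 by rewrite coef_poly ltnNge ni.
rewrite PE' coefMC => /eqP; rewrite mulf_eq0 expf_eq0 polyX_eq0 andbF orbF.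
by move=> /eqP E0; rewrite -iQ' E0 horner0.
Qed.

Lemma infinite_injection (T : Type) (A : set T) : infinite_set A ->
  exists Y : nat -> T, injective Y /\ forall i, A (Y i).
Proof.
move=> /infiniteP/card_leP[X].
exists (fun i => val (X (SigSub (mem_set (I : [set: nat] i))))); split=> [i j|i].
  by move=> /val_inj/inj; rewrite !inE => /(_ I I) [].
exact: set_valP.
Qed.

Lemma range_linear_dependence (F M : fieldType) (E : fieldExtType F)
    (j : {rmorphism E -> M}) (h : {rmorphism F -> M}) (e : nat -> M) :
  (forall a, j a%:A = h a) -> (forall i, range j (e i)) ->
  exists a : nat -> F, \sum_(i < (\dim {:E}).+1) h (a i) * e i = 0 /\
    exists2 i, (i < (\dim {:E}).+1)%N & a i != 0.
Proof.
move=> jA ej; set N := (\dim {:E}).+1.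
have /choice[v vE] i : exists v, j v = e i by have [v _ <-] := ej i; exists v.
have nfree : ~~ free [tuple v i | i < N].
  apply/negP; rewrite /free size_tuple => /eqP E1.
  by have := dimvS (subvf <<[tuple v i | i < N]>>); rewrite E1 ltnn.
apply: contrapT => nex; move/negP: nfree; apply; apply/freeP => a aE i.
apply: contrapT => /eqP ai; apply: nex.
exists (fun l => if insub l is Some l' then a l' else 0); split; last first.
  by exists i; rewrite ?ltn_ord // valK.
apply: etrans (rmorph0 j); rewrite -aE rmorph_sum; apply: eq_bigr => l _ /=.
have -> : [tuple v i | i < N]`_l = v l.
  by rewrite -(tnth_mktuple (fun l : 'I_N => v l) l) (tnth_nth 0).
by rewrite valK -mulr_algl rmorphM /= jA vE.
Qed.

Lemma clear_denominators (R : idomainType) (M : fieldType)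
    (h : {rmorphism {fraction R} -> M}) (g : {rmorphism R -> M})
    (a : nat -> {fraction R}) (e : nat -> M) n :
  (forall x, h (FracField.tofrac x) = g x) ->
  \sum_(i < n) h (a i) * e i = 0 -> (exists2 i, (i < n)%N & a i != 0) ->
  exists b : nat -> R, \sum_(i < n) g (b i) * e i = 0 /\
    exists2 i, (i < n)%N & b i != 0.
Proof.
move=> hg sum0 [i i_n ai0]; have [d [b [d0 db]]] := common_denominator a n.
have dF0 : FracField.tofrac d != 0 by rewrite tofrac_eq0.
exists b; split; last first.
  exists i => //; rewrite -tofrac_eq0 -(db i i_n).
  exact: mulf_neq0.
apply: etrans (mulr0 (h (FracField.tofrac d)));
rewrite -[X in _ = _ * X]sum0 mulr_sumr.
by apply: eq_bigr => l _; rewrite mulrA -rmorphM (db l) // hg.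
Qed.

Section Poles.
Variables (k : closedFieldType) (Om : fieldType) (c : {rmorphism k -> Om}).

Lemma eval_at_residue (O : dvr Om) w q : range c `<=` O -> maxid O w ->
  maxid O (eval_at c w q - c q.[0]).
Proof.
move=> cO mw; have [q1 qE] := poly_split_const q; rewrite {1}qE.
rewrite rmorphD rmorphM /= /eval_at /= /horner_eval map_polyX hornerX map_polyC.
rewrite hornerC addrK; apply: maxidM => //; apply: eval_at_dvr => //.
exact: maxid_sub.
Qed.

Lemma closed_point_eq (L : set Om) (x y : closed_point c L) :
  x = y :> set Om -> x = y.
Proof.
case: x => -[x xr xu] xs xf; case: y => -[y yr yu] ys yf /= xy; subst y.
have E : Dvr xr xu = Dvr yr yu by congr Dvr; exact: Prop_irrelevance.
by case: _ / E in ys yf *; congr ClosedPoint; exact: Prop_irrelevance.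
Qed.

Variable C : smooth_affine_curve c.
Local Notation K := (function_field C).

Lemma coord_function_field a : coord_ring C a -> K a.
Proof.
have [C1 _ _] := coord_subring C.
by move=> Ca; exists a, 1; rewrite divr1.
Qed.

Lemma coord_algdep s t : coord_ring C s -> coord_ring C t -> algdep c s t.
Proof. exact: coord_trdeg_le1. Qed.

(** The generators of the coordinate ring are algebraic over [k(1/s)], so the function field lies in
    a finite extension [E] of it. Were there infinitely many poles, choose [\dim {:E} + 1] of them,
    and for each a function that is a unit there and vanishes at the others. These functions satisfy
    a linear relation with coefficients in [k[1/s]] that do not all vanish at [1/s = 0]. At a pole
    whose coefficient does not vanish, one term of the relation is a unit and all others are in the
    maximal ideal. *)
Lemma finite_poles s : coord_ring C s ->
  finite_set [set x : closed_point c K | ~ x s].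
Proof.
move=> Cs.
have [alg_s|trans_s] := pselect (algebraicOver c s).
  (* An algebraic [s] is a constant and has no poles. *)
  rewrite (_ : [set x | _] = set0) //; apply/seteqP; split=> // x /=; case.
  by apply: point_scalar; exact: algebraic_over_closed.
have trans_w : ~ algebraicOver c s^-1.
  by move=> /algebraic_inv; rewrite invrK.
have [hs hsP] := frac_eval_exists trans_s.
have [h hP] := frac_eval_exists trans_w.
have hX : h (FracField.tofrac 'X) = s^-1.
  by rewrite hP /eval_at /= /horner_eval map_polyX hornerX.
have hC a : h (FracField.tofrac a%:P) = c a.
  by rewrite hP /eval_at /= /horner_eval map_polyC hornerC.
have s0 : s != 0.
  apply: contra_notN trans_s => /eqP->; exact: algebraic0.
have [rs [rsC rs_min]] := coord_fg C.
have [x xrs|E [j [jA jrs jmin]]] := @adjoin_seq_exists _ _ h rs.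
  apply: (frac_eval_algebraic_trans hsP hP).
    by rewrite -[s]invrK; apply: algebraic_inv; rewrite -hX; exact: algebraic_id.
  by apply/(algebraicOver_frac_eval _ hsP); apply: coord_algdep => //; exact: rsC.
have Cj : coord_ring C `<=` range j.
  apply: rs_min; first by case: (range_subfield j).
    by move=> _ [a _ <-]; exists (FracField.tofrac a%:P)%:A; rewrite ?jA ?hC.
  by move=> x /jrs[y <-]; exists y.
have Kj : K `<=` range j.
  move=> _ [a [b [/Cj[a' _ <-] /Cj[b' _ <-] ->]]].
  by exists (a' / b'); rewrite ?fmorph_div.
apply: contrapT => /infinite_injection[Y [Yinj Ys]].
have YK i : fractions (Y i) = K by exact: point_fractions.
have Yneq n1 n2 : Y n1 `<=` Y n2 -> n1 = n2.
  move=> n12; apply/Yinj/closed_point_eq/seteqP; split=> //.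
  exact: (dvr_maximal (YK n1) (YK n2)).
have mw i : maxid (Y i) s^-1.
  by apply: fractions_valuation (Ys i); rewrite YK; exact: coord_function_field.
pose N := (\dim {:E}).+1.
have /choice[e eP] := fun i => unit_at_one YK Yneq i N.
have [i|a [a0 ai0]] := range_linear_dependence (e := e) jA.
  by have [/Kj] := eP i.
have [b [sumb b0]] := clear_denominators (g := eval_at c s^-1) hP a0 ai0.
have [m [b' [bE [i1 i1N b'0]]]] := strip_powers b0.
have {sumb} sumb' : \sum_(i < N) eval_at c s^-1 (b' i) * e i = 0.
  apply: (mulfI (expf_neq0 m (invr_neq0 s0))); rewrite mulr0 -[RHS]sumb mulr_sumr.
  apply: eq_bigr => i _; rewrite bE // rmorphM /=.
  rewrite [eval_at _ _ 'X^m]/eval_at /= /horner_eval map_polyXn hornerXn.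
  by rewrite mulrCA mulrA.
have cY i : range c `<=` Y i by exact: point_scalar.
have [_ Ye nme _] := eP i1.
have evO q : Y i1 (eval_at c s^-1 q).
  by apply: eval_at_dvr => //; exact: maxid_sub.
have : maxid (Y i1) (eval_at c s^-1 (b' i1) * e i1).
  move: sumb'; rewrite (bigD1 (Ordinal i1N)) //= => /eqP.
  rewrite addr_eq0 => /eqP->; rewrite -sub0r; apply: maxidB; first exact: maxid0.
  apply: maxid_sum => i ii1; apply: maxidM => //.
  by have [_ _ _] := eP i; apply=> //; rewrite eq_sym.
move=> /maxid_prime[||mb|//] //.
have := maxidB mb (eval_at_residue (b' i1) (cY i1) (mw i1)).
by rewrite subKr => /(const_unit (cY i1))/eqP; rewrite (negPf b'0).
Qed.

End Poles.

(** * Residue fields of covers, and points regular on the coordinate ring *)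

Section Points.
Variables (k : closedFieldType) (Om : fieldType) (c : {rmorphism k -> Om}).
Variable C : smooth_affine_curve c.
Local Notation K := (function_field C).
Local Notation A := (coord_ring C).

Lemma cover_algebraic L s h z : finite_galois K L -> A s -> frac_eval c s h ->
  L z -> algebraicOver h z.
Proof.
move=> [_ _ _ Lnorm] As hP Lz.
have algK w : K w -> integralOver h w.
  move=> [a [b [Aa Ab ->]]].
  have algA u : A u -> integralOver h u.
    move=> Au; apply/integral_algebraic/(algebraicOver_frac_eval u hP).
    exact: (coord_algdep As Au).
  by apply: integral_div; exact: algA.
have [p [pK psep pz _]] := Lnorm z Lz.
apply/integral_algebraic/(integral_root _ pz); first exact: separable_poly_neq0.
by apply/integral_poly => i; exact: algK.
Qed.

Lemma cover_residue L (y : closed_point c L) u : finite_galois K L -> y u ->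
  exists a, maxid y (u - c a).
Proof.
move=> Lgal yu; have [s [As trans_s]] := coord_transcendental C.
have [h hP] := frac_eval_exists trans_s.
apply: (residue_exists _ hP) => // [|z yz]; first exact: point_scalar.
apply: (cover_algebraic Lgal As hP).
by rewrite -(point_fractions y); exact: fractions_dvr.
Qed.

Lemma function_field_subfield : is_subfield K.
Proof.
have Cring := coord_subring C; have [A1 AB AM] := Cring.
have A0 := mem_subring0 Cring.
split; last by move=> _ [a [b [Aa Ab ->]]]; exists b, a; rewrite invf_div.
split; first exact: coord_function_field.
  move=> _ _ [a [b [Aa Ab ->]]] [a' [b' [Aa' Ab' ->]]].
  have [->|b0] := eqVneq b 0; first by exists (- a'), b'; split=> //;
    [rewrite -sub0r; exact: (AB)|rewrite invr0 mulr0 sub0r mulNr].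
  have [->|b'0] := eqVneq b' 0.
    by exists a, b; split=> //; rewrite invr0 mulr0 subr0.
  exists (a * b' - a' * b), (b * b'); split; [by apply: (AB); exact: (AM)|exact: (AM)|].
  by field; rewrite b0 b'0.
move=> _ _ [a [b [Aa Ab ->]]] [a' [b' [Aa' Ab' ->]]].
by exists (a * a'), (b * b'); split; rewrite ?mulf_div //; exact: (AM).
Qed.

Lemma base_residue (x : closed_point c K) u : x u -> exists a, maxid x (u - c a).
Proof. exact/cover_residue/finite_galois_refl/function_field_subfield. Qed.

(** The trace [m] on [A] of the maximal ideal of [x] is maximal, because the residue field is [k].
    Clearly [A_m] is contained in [x]. Conversely, by regularity each nonzero element of [A] is a
    unit of [A_m] times a power of the generator [t] of [m], and a quotient of two such elements
    that lies in [x] cannot involve a negative power of [t]. *)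
Lemma coord_sub_on_curve (x : closed_point c K) : A `<=` x -> on_curve x.
Proof.
move=> Ax; have Cring := coord_subring C; have [A1 AB AM] := Cring.
pose m : set Om := [set a | A a /\ maxid x a].
have mmax : maximal_ideal A m.
  split; first split.
  - by move=> a [].
  - by split; [exact: mem_subring0|exact: maxid0].
  - by move=> a b [Aa ma] [Ab mb]; split; [exact: (AB)|exact: maxidB].
  - by move=> a b Aa [Ab mb]; split; [exact: (AM)|apply: maxidM => //; exact: Ax].
  - by case=> _ /maxid1.
  - move=> J [JA J0 JB JM] mJ.
    have [|] := pselect (J `<=` m); [by right|move=> Jm; left].
    have [z [Jz nmz]] : exists z, J z /\ ~ m z.
      apply: contrapT => nex; apply: Jm => z Jz; apply: contrapT => nmz.
      by apply: nex; exists z.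
    have [a mza] := base_residue (Ax _ (JA _ Jz)).
    have a0 : a != 0.
      apply: contra_notN nmz => /eqP a0; move: mza.
      by rewrite a0 rmorph0 subr0 => mz; split=> //; exact: JA.
    have Aa b : A (c b) by apply: coord_scalar; exists b.
    rewrite (_ : 1 = c a^-1 * (z - (z - c a))).
      apply: (JM) => //; apply: (JB) => //; apply: mJ; split=> //.
      by apply: (AB) => //; exact: JA.
    by rewrite subKr -rmorphM mulVf // rmorph1.
exists m; split=> //; apply/seteqP; split; last first.
  move=> _ [a [s [Aa As nms ->]]]; apply: dvrM; first exact: Ax.
  by case: (notin_maxid (Ax _ As)) => // ms; apply: nms.
have [t [[At mt] tP]] := coord_regular mmax.
have mE a : A a -> ~ m a -> ~ maxid x a by move=> Aa nma ma; apply: nma.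
(* [n] bounds how often [t] can be divided out, which makes the recursion terminate. For a given
   nonzero [b] the bound will be its valuation at [x] plus one. *)
have decomp n b : A b -> ~ maxid_pow x n b ->
    exists l s b',
      [/\ A s, ~ maxid x s, A b', ~ maxid x b' & s * b = t ^+ l * b'].
  elim: n b => [|n IHn] b Ab nb.
    case: nb; exists b, 0; rewrite expr0 mulr1; split=> //; first exact: Ax.
    exact: maxid0.
  have [mb|nmb] := pselect (maxid x b); last first.
    by exists 0%N, 1, b; rewrite expr0 !mul1r; split=> //; exact: maxid1.
  have [s [b1 [As nms Ab1 sb]]] := tP b (conj Ab mb).
  have {}nms := mE s As nms; have [s0 xs] := notin_maxid (Ax _ As) nms.
  have [//|mb1|l [s1 [b' [As1 nms1 Ab' nmb' E]]]] := IHn b1.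
    apply: nb; rewrite -[b](mulKf s0) sb; apply: maxid_powM => //.
    by rewrite -add1n; apply: maxid_powXM => //; rewrite -maxidE.
  exists l.+1, (s1 * s), b'; split=> //; first exact: (AM).
    by move=> /maxid_prime[||//|//]; exact: Ax.
  by rewrite -mulrA sb mulrCA E mulrA -exprS.
have {}decomp b : A b -> b != 0 ->
    exists l s b',
      [/\ A s, ~ maxid x s, A b', ~ maxid x b' & s * b = t ^+ l * b'].
  move=> Ab b0; have [w wU] := dvr_uniformizer x.
  have [n [u [u0 xu xuV bE]]] := uniformizer_decomp wU (Ax _ Ab) b0.
  apply: (decomp n.+1) => //; rewrite bE => /(maxid_pow_unit _ _ wU u0 xu xuV).
  by rewrite ltnn.
move=> z xz.
have : fractions A z.
  by rewrite -[fractions A]/K -(point_fractions x); exact: fractions_dvr.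
case=> a [b [Aa Ab zE]].
have A0 := mem_subring0 Cring.
have [z0|z0] := eqVneq z 0.
  by exists 0, 1; rewrite z0 mul0r; split=> //; case=> _ /maxid1.
have a0 : a != 0 by apply: contraNneq z0; rewrite zE => ->; rewrite mul0r.
have b0 : b != 0 by apply: contraNneq z0; rewrite zE => ->; rewrite invr0 mulr0.
have [n [s [a' [As nms Aa' nma' sa]]]] := decomp a Aa a0.
have [l [s' [b' [As' nms' Ab' nmb' sb]]]] := decomp b Ab b0.
have nz u : A u -> ~ maxid x u -> u != 0.
  by move=> Au nmu; have [] := notin_maxid (Ax _ Au) nmu.
have tn0 : t ^+ n != 0.
  by have := mulf_neq0 (nz s As nms) a0; rewrite sa mulf_eq0 negb_or => /andP[].
have tl0 : t ^+ l != 0.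
  by have := mulf_neq0 (nz s' As' nms') b0; rewrite sb mulf_eq0 negb_or => /andP[].
have npr u v : A u -> A v -> ~ maxid x u -> ~ maxid x v -> ~ maxid x (u * v).
  by move=> Au Av nu nv /maxid_prime[||//|//]; exact: Ax.
have zE' : z * (t ^+ l * (s * b')) = t ^+ n * (a' * s').
  have zb : z * b = a by rewrite zE divfK.
  have -> : z * (t ^+ l * (s * b')) = z * s * (t ^+ l * b') by ring.
  rewrite -sb; have -> : z * s * (s' * b) = s * (z * b) * s' by ring.
  by rewrite zb sa -mulrA.
have [ln|nl] := leqP l n.
  exists (t ^+ (n - l) * (a' * s')), (s * b'); split=> //.
  - by apply: (AM); [exact: mem_subringX|exact: (AM)].
  - exact: (AM).
  - by case=> _; exact: npr.
  - apply: (mulIf (mulf_neq0 (nz s As nms) (nz b' Ab' nmb'))).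
    rewrite divfK ?mulf_neq0 ?nz //; apply: (mulIf tl0).
    rewrite [RHS]mulrAC -exprD subnK // -zE'; ring.
(* If the power of [t] in the denominator were larger, the unit [a' * s'] would be a multiple of [t]
   in [x]. *)
exfalso; apply: (npr a' s') => //.
have -> : a' * s' = z * (s * b') * t ^+ (l - n).-1 * t.
  have tlE : t ^+ l = t ^+ (l - n).-1 * t * t ^+ n.
    by rewrite -exprSr prednK ?subn_gt0 // -exprD subnK // ltnW.
  by apply: (mulfI tn0); rewrite -zE' tlE; ring.
apply: maxidM => //; apply: dvrM; last by apply: dvrX; exact: maxid_sub.
by apply: dvrM => //; apply: dvrM; exact: Ax.
Qed.

Lemma finite_punctures : finite_set (punctures C).
Proof.
have [rs [rsA rs_min]] := coord_fg C.
apply: (@sub_finite_set _ _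
    (\bigcup_(a in [set` rs]) [set x : closed_point c K | ~ x a])); last first.
  by apply: bigcup_finite => // a /= ars; exact/finite_poles/rsA.
move=> x nx; apply: contrapT => nP; apply: nx; apply: coord_sub_on_curve.
apply: rs_min; [exact: dvr_subring|exact: point_scalar|move=> a ars].
by apply: contrapT => nxa; apply: nP; exists a.
Qed.

End Points.

(** * Completed fields *)

Section CompletedClass.
Variables (F : fieldType) (O : dvr F).

Lemma completed_class_zmod_morphism : zmod_morphism (@completed_class F O).
Proof. by move=> f g; rewrite /completed_class rmorphB tofracB. Qed.

Lemma completed_class_monoid_morphism : monoid_morphism (@completed_class F O).
Proof.
by split=> [|f g]; rewrite /completed_class ?rmorph1 ?tofrac1 ?rmorphM ?tofracM.
Qed.

HB.instance Definition _ := GRing.isZmodMorphism.Build (cseq O) (completed_field O)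
  (@completed_class F O) completed_class_zmod_morphism.
HB.instance Definition _ := GRing.isMonoidMorphism.Build (cseq O) (completed_field O)
  (@completed_class F O) completed_class_monoid_morphism.

Lemma completed_class_eq0 (f : cseq O) :
  completed_class f = 0 <-> forall n, maxid_pow O n (f n).
Proof.
have E : (completed_class f == 0) = (f \in null_ideal O).
  rewrite /completed_class tofrac_eq0 -[f in RHS]subr0 Quotient.idealrBE.
  rewrite -[RHS]/(\pi f == \pi 0)%qT.
  by rewrite (rmorph0 (\pi_({ideal_quot (null_ideal O)})%qT)).
split=> [/eqP|nf]; first by rewrite E => /asboolP.
by apply/eqP; rewrite E; apply/asboolP.
Qed.

Lemma completed_field_div (z : completed_field O) :
  exists f g : cseq O, completed_class g != 0 /\
    z = completed_class f / completed_class g.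
Proof.
have [[a b] [b0 ->]] := fraction_div z.
by exists (repr a), (repr b); rewrite /completed_class !reprK tofrac_eq0.
Qed.

End CompletedClass.

Section DvrClass.
Variables (F : fieldType) (O : dvr F).

Lemma const_coherent z : O z -> coherent O (fun=> z).
Proof. by move=> Oz n; split=> //; rewrite subrr; exact: maxid_pow0. Qed.

Definition const_cseq z (Oz : O z) : cseq O := Cseq (asboolT (const_coherent Oz)).

(* junk value [0] outside [O] *)
Definition dvr_class z : completed_field O :=
  if pselect (O z) is left Oz then completed_class (const_cseq Oz) else 0.

Lemma dvr_classE z (Oz : O z) : dvr_class z = completed_class (const_cseq Oz).
Proof.
rewrite /dvr_class; case: pselect => // Oz'; congr (completed_class (const_cseq _)).
exact: Prop_irrelevance.
Qed.

Lemma dvr_class_eq z (f : cseq O) : O z -> (forall n, f n = z) ->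
  completed_class f = dvr_class z.
Proof.
move=> Oz fz; rewrite (dvr_classE Oz); congr completed_class; apply: val_inj.
by apply/funext => n; rewrite /= fz.
Qed.

Lemma dvr_classB x y : O x -> O y -> dvr_class (x - y) = dvr_class x - dvr_class y.
Proof.
move=> Ox Oy; rewrite (dvr_classE Ox) (dvr_classE Oy) -rmorphB.
by apply/esym/dvr_class_eq => //; exact: dvrB.
Qed.

Lemma dvr_classM x y : O x -> O y -> dvr_class (x * y) = dvr_class x * dvr_class y.
Proof.
move=> Ox Oy; rewrite (dvr_classE Ox) (dvr_classE Oy) -rmorphM.
by apply/esym/dvr_class_eq => //; exact: dvrM.
Qed.

Lemma dvr_class1 : dvr_class 1 = 1.
Proof.
rewrite -(rmorph1 (@completed_class F O)); apply/esym/dvr_class_eq => //.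
exact: dvr1.
Qed.

Lemma dvr_classX x n : O x -> dvr_class (x ^+ n) = dvr_class x ^+ n.
Proof.
move=> Ox; elim: n => [|n IHn]; first exact: dvr_class1.
by rewrite !exprS dvr_classM ?IHn //; exact: dvrX.
Qed.

Lemma dvr_class_neq0 z : O z -> z != 0 -> dvr_class z != 0.
Proof.
move=> Oz z0; rewrite (dvr_classE Oz); apply/eqP => /completed_class_eq0 nz.
have [t tU] := dvr_uniformizer O.
have [n [u [u0 Ou OuV zE]]] := uniformizer_decomp tU Oz z0.
have := nz n.+1; rewrite /= zE => /(maxid_pow_unit _ _ tU u0 Ou OuV).
by rewrite ltnn.
Qed.

Section FieldLift.
Variables (L : fieldType) (i : {rmorphism L -> F}).
Hypothesis iL : range i = fractions O.

(** Embeds the function field in its completion by constant sequences. The formula covers every way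
    of writing an element as a fraction, so the fractions chosen in the construction do not matter
    later. *)
Lemma fractions_lift : exists lam : {rmorphism L -> completed_field O},
  forall z a b, O a -> O b -> b != 0 -> i z = a / b ->
    lam z = dvr_class a / dvr_class b.
Proof.
have /choice[ab abP] z : exists ab : F * F,
    [/\ O ab.1, O ab.2, ab.2 != 0 & i z = ab.1 / ab.2].
  have : fractions O (i z) by rewrite -iL; exists z.
  (* [fractions] allows the denominator [0], where [a / 0 = 0]; such a fraction is replaced by
     [0 / 1]. *)
  case=> a [b [Oa Ob zE]]; have [b0|b0] := eqVneq b 0; last by exists (a, b).
  exists (0, 1); rewrite /= oner_eq0 zE b0 invr0 mulr0 mul0r.
  by split=> //; [exact: dvr0|exact: dvr1].
pose lam z := dvr_class (ab z).1 / dvr_class (ab z).2.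
have lamE z a b : O a -> O b -> b != 0 -> i z = a / b ->
    lam z = dvr_class a / dvr_class b.
  move=> Oa Ob b0 zE; have [] := abP z; rewrite /lam; case: (ab z) => a' b' /=.
  move=> Oa' Ob' b'0 /eqP; rewrite zE eqr_div // => /eqP E.
  by apply/eqP; rewrite eqr_div ?dvr_class_neq0 // -!dvr_classM // E.
have lamB : zmod_morphism lam.
  move=> z w; have [Oa Ob b0 zE] := abP z; have [Oa' Ob' b'0 wE] := abP w.
  rewrite {2 3}/lam.
  rewrite (lamE _ ((ab z).1 * (ab w).2 - (ab w).1 * (ab z).2) ((ab z).2 * (ab w).2)).
  - apply/esym; rewrite -mulNr addf_div ?dvr_class_neq0 // mulNr.
    by rewrite dvr_classB ?dvr_classM //; exact: dvrM.
  - by apply: dvrB; exact: dvrM.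
  - exact: dvrM.
  - exact: mulf_neq0.
  - by rewrite rmorphB zE wE; field; rewrite b0 b'0.
have lamM : monoid_morphism lam.
  split=> [|z w].
    rewrite (lamE _ 1 1) ?divr1 ?dvr_class1 ?divr1 ?rmorph1 ?oner_eq0 //.
      exact: dvr1.
    exact: dvr1.
  have [Oa Ob b0 zE] := abP z; have [Oa' Ob' b'0 wE] := abP w.
  rewrite {2 3}/lam (lamE _ ((ab z).1 * (ab w).1) ((ab z).2 * (ab w).2)).
  - by rewrite !dvr_classM // mulf_div.
  - exact: dvrM.
  - exact: dvrM.
  - exact: mulf_neq0.
  - by rewrite rmorphM zE wE mulf_div.
pose lamR : {rmorphism L -> completed_field O} := HB.pack lam
  (GRing.isZmodMorphism.Build _ _ lam lamB) (GRing.isMonoidMorphism.Build _ _ lam lamM).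
by exists lamR.
Qed.

End FieldLift.
End DvrClass.

(** * Points lying over a point *)

Section LyingOver.
Variables (k : closedFieldType) (Om : fieldType) (c : {rmorphism k -> Om}).
Variables (K L : set Om) (y : closed_point c L) (x : closed_point c K).
Hypothesis yx : lies_over y x.

Lemma over_sub z : x z -> y z.
Proof. by rewrite [X in X z]yx => -[]. Qed.

Lemma over_cseq_zmod_morphism : zmod_morphism (over_cseq yx).
Proof. by move=> f g; apply: val_inj. Qed.

Lemma over_cseq_monoid_morphism : monoid_morphism (over_cseq yx).
Proof. by split=> [|f g]; apply: val_inj. Qed.

HB.instance Definition _ := GRing.isZmodMorphism.Build (cseq x) (cseq y)
  (over_cseq yx) over_cseq_zmod_morphism.
HB.instance Definition _ := GRing.isMonoidMorphism.Build (cseq x) (cseq y)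
  (over_cseq yx) over_cseq_monoid_morphism.


(** [e] is the ramification index. It is positive: for [e = 0] the inverse of [w] would lie in [y]
    and in [K], hence in [x]. *)
Lemma ramification_exists w : uniformizer x w ->
  exists e t u, [/\ (0 < e)%N, uniformizer y t, [/\ u != 0, y u & y u^-1]
    & w = u * t ^+ e].
Proof.
move=> wU; have [xw w0 nw _] := wU; have [t tU] := dvr_uniformizer y.
have [e [u [u0 yu yuV wE]]] := uniformizer_decomp tU (over_sub xw) w0.
exists e, t, u; split=> //; rewrite lt0n; apply/eqP => e0; apply: nw.
rewrite [X in X _]yx; split; first by rewrite wE e0 expr0 mulr1.
by rewrite -(point_fractions x); exists 1, w; rewrite mul1r; split=> //; exact: dvr1.
Qed.

Section Ramified.
Variables (w t u : Om) (e : nat).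
Hypotheses (wU : uniformizer x w) (tU : uniformizer y t) (e0 : (0 < e)%N).
Hypotheses (u0 : u != 0) (yu : y u) (yuV : y u^-1) (wE : w = u * t ^+ e).

Let yt : y t. Proof. by case: tU. Qed.
Let t0 : t != 0. Proof. by case: tU. Qed.
Let xw : x w. Proof. by case: wU. Qed.
Let w0 : w != 0. Proof. by case: wU. Qed.

Lemma maxid_pow_over_unit m l v : v != 0 -> x v -> x v^-1 ->
  maxid_pow y m (v * w ^+ l) <-> (m <= e * l)%N.
Proof.
move=> v0 xv xvV; rewrite wE exprMn mulrA -exprM; apply: maxid_pow_unit => //.
- by rewrite mulf_neq0 // expf_neq0.
- by apply: dvrM; [exact: over_sub|exact: dvrX].
- by rewrite invfM -exprVn; apply: dvrM; [exact: over_sub|exact: dvrX].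
Qed.

Lemma maxid_pow_over n z : x z -> maxid_pow y (e * n) z <-> maxid_pow x n z.
Proof.
move=> xz; have [->|z0] := eqVneq z 0; first by split=> _; exact: maxid_pow0.
have [l [v [v0 xv xvV ->]]] := uniformizer_decomp wU xz z0.
by rewrite (maxid_pow_unit _ _ wU v0 xv xvV) maxid_pow_over_unit // leq_pmul2l.
Qed.

(** By [maxid_pow_over] the valuation at [y] is [e] times the one at [x]. So a sequence that is null
    at [y] has its term of index [e * n] in the [n]-th power of the maximal ideal of [x], and that
    term agrees with the [n]-th one modulo this power. *)
Lemma over_class_eq0 (f : cseq x) :
  completed_class (over_cseq yx f) = 0 <-> completed_class f = 0.
Proof.
rewrite !completed_class_eq0; split=> nf n.
  have fn : maxid_pow x n (f (e * n)%N).
    by apply/maxid_pow_over; [exact: cseqO|exact: nf].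
  rewrite -[f n](subKr (f (e * n)%N)); apply: maxid_powB => //.
  by apply: cseq_sub; rewrite leq_pmull.
apply: (@maxid_pow_le _ _ _ (e * n)); first by rewrite leq_pmull.
by apply/maxid_pow_over; [exact: cseqO|exact: nf].
Qed.

Lemma completed_over_exists :
  exists j : {rmorphism completed_field x -> completed_field y},
    forall f, j (completed_class f) = completed_class (over_cseq yx f).
Proof.
pose h f := completed_class (over_cseq yx f).
have hB : {morph h : f g / f - g} by move=> f g; rewrite /h !rmorphB.
have hM : {morph h : f g / f * g} by move=> f g; rewrite /h !rmorphM.
pose r (q : completed_ring x) := h (repr q).
have rE f : r (\pi_({ideal_quot (null_ideal x)})%qT f) = h f.
  apply/eqP; rewrite -subr_eq0 -hB; apply/eqP/over_class_eq0.
  rewrite rmorphB; apply/eqP; rewrite subr_eq0 /=.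
  by rewrite -[X in X == _]/(FracField.tofrac _) reprK.
have rB : zmod_morphism r.
  by elim/quotW=> f; elim/quotW=> g; rewrite -rmorphB !rE.
have rM : monoid_morphism r.
  split.
    by rewrite -(rmorph1 (\pi_({ideal_quot (null_ideal x)})%qT)) rE /h !rmorph1.
  by elim/quotW=> f; elim/quotW=> g; rewrite -rmorphM !rE.
pose rR : {rmorphism completed_ring x -> completed_field y} := HB.pack r
  (GRing.isZmodMorphism.Build _ _ r rB) (GRing.isMonoidMorphism.Build _ _ r rM).
have rinj : injective rR.
  apply: raddf_inj; elim/quotW=> f rf0.
  have /over_class_eq0/eqP : h f = 0 by rewrite -rE; exact: rf0.
  by rewrite /completed_class tofrac_eq0 => /eqP.
have [j jE] := fraction_lift rinj.
by exists j => f; rewrite [LHS]jE [LHS]rE.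
Qed.

Hypothesis residue : forall z, y z -> exists a, maxid y (z - c a).

Lemma residue_expansion z n : y z -> exists (a : nat -> k) z',
  y z' /\ z = \sum_(i < n) c (a i) * t ^+ i + t ^+ n * z'.
Proof.
move=> yz; elim: n => [|n [a [z' [yz' ->]]]].
  by exists (fun=> 0), z; rewrite big_ord0 add0r mul1r.
have [b] := residue yz'; rewrite (maxid_uniformizer tU) => -[v [yv vE]].
exists (fun i => if i == n then b else a i), v; split=> //.
rewrite big_ord_recr /= eqxx -addrA; congr (_ + _).
  by apply: eq_bigr => i _; rewrite ltn_eqF.
by rewrite -[z'](subrK (c b)) vE exprSr; ring.
Qed.

(** Since [t ^+ e = u^-1 * w], a block of [e] digits leaves a remainder divisible by [w]. The
    hypothesis [y z] comes after the existential so that [choice] yields a total function. *)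
Lemma digit_exists z : exists az : (nat -> k) * Om, y z ->
  y az.2 /\ z = \sum_(i < e) c (az.1 i) * t ^+ i + w * az.2.
Proof.
have [yz|nz] := pselect (y z); last by exists (fun=> 0, 0).
have [a [z' [yz' zE]]] := residue_expansion e yz.
exists (a, u^-1 * z') => _; split; first exact: dvrM.
by rewrite {1}zE wE mulrACA divff // mul1r.
Qed.

(* The digit expansions in [k[w]] of the terms of a coherent sequence of [y]
   converge in [x]. *)
Lemma completed_span (g : cseq y) : exists f : nat -> cseq x,
  completed_class g =
    \sum_(i < e) completed_class (over_cseq yx (f i)) * dvr_class y t ^+ i.
Proof.
have /choice[D DP] := digit_exists.
(* [g] is sampled at multiples of [e] because [w ^+ n] has valuation [e * n] at [y]. [R n] is the
   remainder of [g (e * n)] after [n] blocks of digits, divided by [w ^+ n]. Adding the next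
   increment [dl n] and expanding once more gives the coefficients [dig n] of [w ^+ n]. *)
pose dl n := (g (e * n.+1)%N - g (e * n)%N) / w ^+ n.
pose R := fix R n := if n is n'.+1 then (D (R n' + dl n')).2 else g 0%N.
pose dig n := (D (R n + dl n)).1.
have ydl n : y (dl n).
  have : maxid_pow y (e * n) (g (e * n.+1)%N - g (e * n)%N).
    by apply: cseq_sub; rewrite leq_mul2l leqnSn orbT.
  rewrite (maxid_powE _ tU) => -[a [ya gE]].
  rewrite /dl gE wE exprMn -exprM [X in _ / X]mulrC invfM mulrA mulfK ?expf_neq0 //.
  by rewrite -exprVn; apply: dvrM => //; exact: dvrX.
have yR n : y (R n).
  elim: n => [|n IHn]; first exact: cseqO.
  by have [] := DP _ (dvrD IHn (ydl n)).
pose f i n := \sum_(m < n) c (dig m i) * w ^+ m.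
have fS i n : f i n.+1 = f i n + c (dig n i) * w ^+ n by rewrite /f big_ord_recr.
have xc a : x (c a) by apply: point_scalar; exists a.
have fcoh i : coherent x (f i).
  move=> n; split.
    by apply: mem_subring_sum => [|m _]; [exact: dvr_subring|apply/dvrM/dvrX].
  rewrite fS addrAC subrr add0r; apply: maxid_powM => //.
  by apply: maxid_powX; exact: uniformizer_maxid.
have gE n : g (e * n)%N = \sum_(i < e) f i n * t ^+ i + w ^+ n * R n.
  elim: n => [|n IHn].
    by rewrite muln0 mul1r big1 ?add0r // => i _; rewrite /f big_ord0 mul0r.
  have [_ E] := DP _ (dvrD (yR n) (ydl n)).
  have -> : g (e * n.+1)%N = g (e * n)%N + w ^+ n * dl n.
    by rewrite /dl mulrC divfK ?expf_neq0 // addrC subrK.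
  rewrite IHn -addrA -mulrDr {1}E -/(dig n) -[(D _).2]/(R n.+1).
  rewrite mulrDr addrA mulrA -exprSr; congr (_ + _).
  rewrite mulr_sumr -big_split; apply: eq_bigr => i _ /=.
  by rewrite fS mulrDl mulrCA mulrA.
exists (fun i => Cseq (asboolT (fcoh i))); apply/eqP.
rewrite -subr_eq0 (dvr_classE yt); under eq_bigr do rewrite -rmorphXn -rmorphM.
rewrite -rmorph_sum -rmorphB; apply/eqP/completed_class_eq0 => n.
set S := \sum_(i < e) _.
have SE : S n = \sum_(i < e) f i n * t ^+ i.
  rewrite /S; elim/big_ind2: _ => // [a1 b1 a2 b2 <- <- //|i _].
  rewrite -[LHS]/(f i n * (const_cseq yt ^+ i : cseq y) n); congr (_ * _).
  by elim: (i : nat) => // m IHm; rewrite !exprS -IHm.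
rewrite -[X in maxid_pow _ _ X]/(g n - S n) SE.
rewrite (_ : _ - _ = (g n - g (e * n)%N) + w ^+ n * R n); last first.
  by rewrite gE; ring.
apply: maxid_powD.
  rewrite -opprB; apply: maxid_powN; apply: cseq_sub; by rewrite leq_pmull.
apply: maxid_powMr => //; apply: maxid_powX.
rewrite wE -(prednK e0) exprSr mulrA; apply: maxidM; last exact: uniformizer_maxid.
by apply: dvrM => //; exact: dvrX.
Qed.

End Ramified.
End LyingOver.

(** * Embeddings of completed fields and the ramification index *)

Section Embedding.
Variables (k : closedFieldType) (Om : fieldType) (c : {rmorphism k -> Om}).
Variables (K L : set Om) (y : closed_point c L) (x : closed_point c K).
Hypothesis yx : lies_over y x.
Variables (w t u : Om) (e : nat).
Hypotheses (wU : uniformizer x w) (tU : uniformizer y t) (e0 : (0 < e)%N).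
Hypotheses (u0 : u != 0) (yu : y u) (yuV : y u^-1) (wE : w = u * t ^+ e).
Hypothesis residue : forall z, y z -> exists a, maxid y (z - c a).
Variables (M : closedFieldType) (i : {rmorphism completed_field x -> M}).

(** By [completed_span] every class at [y] is a polynomial of degree less than [e] in [T], the class
    of [t], so an embedding is determined by the image of [T]. This reduces containment of the image
    in [E] to that of one element. For [e = 1] these polynomials are constant, and [T] itself comes
    from the completed field of [x]. *)
Lemma embedding_exists : exists phi : {rmorphism completed_field y -> M},
  [/\ forall f, phi (completed_class (over_cseq yx f)) = i (completed_class f),
      forall E, is_subfield E -> range i `<=` E -> E (phi (dvr_class y t)) ->
        range phi `<=` E
    & e = 1%N -> range i (phi (dvr_class y t))].
Proof.
have [yt t0 _ _] := tU; have [xw w0 _ _] := wU.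
have span := completed_span yx wU tU e0 u0 yu yuV wE residue.
have [j jE] := completed_over_exists yx wU tU e0 u0 yu yuV wE.
set T := dvr_class y t in span *.
have class_poly g : exists q : {poly completed_field x}, [/\ (size q <= e)%N,
    completed_class g = (map_poly j q).[T] &
    exists f, q = \poly_(l < e) completed_class (f l : cseq x)].
  have [f ->] := span g; exists (\poly_(l < e) completed_class (f l)).
  split; [exact: size_poly| |by exists f].
  rewrite (@horner_coef_wide _ e); last first.
    by rewrite size_map_poly; exact: size_poly.
  by apply: eq_bigr => l _; rewrite coef_map /= coef_poly ltn_ord -jE.
have alg_T : algebraicOver j T.
  have [q [sq qE [f fE]]] := class_poly (const_cseq yuV).
  (* [q] represents the class of [u^-1], so [P] expresses [t ^+ e = w * u^-1]. It is nonzero because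
     [q] has degree less than [e]. *)
  pose P := 'X^e - completed_class (const_cseq xw) *: q.
  have sP : (size (completed_class (const_cseq xw) *: q) <= e)%N.
    exact: leq_trans (size_scale_leq _ _) sq.
  exists P.
    by rewrite -size_poly_eq0 size_polyDl size_polyXn ?size_polyN ?ltnS.
  rewrite /root rmorphB /= map_polyXn map_polyZ hornerD hornerN hornerZ hornerXn.
  rewrite -qE jE -[completed_class (const_cseq yuV)]dvr_classE.
  have -> : completed_class (over_cseq yx (const_cseq xw)) = dvr_class y w.
    by apply: dvr_class_eq => //; exact: (over_sub yx).
  rewrite /T -dvr_classX // -dvr_classM //; last exact: (over_sub yx).
  rewrite (_ : w * u^-1 = t ^+ e) ?subrr //.
  by rewrite wE mulrAC divff // mul1r.
have all_poly z : exists q, z = (map_poly j q).[T].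
  have [f [g [_ ->]]] := completed_field_div z.
  have [q [_ -> _]] := class_poly f; have [r [_ -> _]] := class_poly g.
  have [r' ->] := inv_in_adjoin r alg_T.
  by exists (q * r'); rewrite rmorphM hornerM.
have [phi phiE] := simple_embedding i alg_T all_poly.
exists phi; split=> [f|E Efield iE ET _ [z _ <-]|e1].
- by rewrite -jE phiE.
- have [q ->] := all_poly z; rewrite -horner_map -map_poly_comp.
  apply: mem_subring_horner => //; first by case: Efield.
  by move=> l; rewrite coef_map /= phiE; apply: iE; exists q`_l.
- have [q [sq qE _]] := class_poly (const_cseq yt).
  rewrite -[completed_class _]dvr_classE -/T in qE.
  rewrite qE [q]size1_polyC -?e1 // map_polyC hornerC phiE.
  by exists q`_0.
Qed.

End Embedding.

Section EtaleIndex.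
Variables (k : closedFieldType) (Om : fieldType) (c : {rmorphism k -> Om}).
Variables (K L : set Om) (y : closed_point c L) (x : closed_point c K).
Hypothesis yx : lies_over y x.
Variables (w t u : Om) (e : nat).
Hypotheses (wU : uniformizer x w) (tU : uniformizer y t) (e0 : (0 < e)%N).
Hypotheses (u0 : u != 0) (yu : y u) (yuV : y u^-1) (wE : w = u * t ^+ e).

(** If [w] generates the maximal ideal of [y], then [t] is a multiple of [w], and comparing
    valuations gives [e <= 1]. *)
Lemma etale_index : etale_at y x -> e = 1%N.
Proof.
move=> et; have [a [b []]] := et t (uniformizer_maxid tU).
rewrite (maxid_uniformizer wU) => -[a' [xa' ->]] yb tE.
apply/eqP; rewrite eqn_leq e0 andbT.
apply/(maxid_pow_unit e 1 tU (oner_neq0 _)); rewrite ?invr1; try exact: dvr1.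
rewrite mul1r expr1 tE (maxid_powE _ tU); exists (a' * u * b); split.
  by do 2?apply: dvrM => //; exact: (over_sub yx).
by rewrite wE; ring.
Qed.

Lemma index_etale : e = 1%N -> etale_at y x.
Proof.
move=> e1 z; rewrite (maxid_uniformizer tU) => -[a [ya ->]].
exists w, (a * u^-1); split; [exact: uniformizer_maxid|exact: dvrM|].
by rewrite wE e1 expr1; field.
Qed.

(** If the class of [t] is a quotient [f / g] from the completed field of [x], then [t * g = f] in
    the completion at [y]. The valuation of the left side is congruent to [1] modulo [e], that of
    the right side to [0], so [e = 1]. The argument is carried out on terms [F] and [G] of the
    sequences, modulo a power beyond the valuation of [t * G]. *)
Lemma completed_trivial_index (M : fieldType)
    (i : {rmorphism completed_field x -> M})
    (phi : {rmorphism completed_field y -> M}) :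
  (forall f, phi (completed_class (over_cseq yx f)) = i (completed_class f)) ->
  range phi `<=` range i -> e = 1%N.
Proof.
move=> phiE phi_i; have [yt _ _ _] := tU.
have [a _ aE] := phi_i (phi (dvr_class y t)) (ex_intro2 _ _ _ I erefl).
have [f [g [g0 aE']]] := completed_field_div a.
have : phi (completed_class (const_cseq yt * over_cseq yx g - over_cseq yx f)) = 0.
  rewrite rmorphB rmorphM /= rmorphB rmorphM /= !phiE -dvr_classE -aE aE' fmorph_div.
  by rewrite divfK ?subrr // fmorph_eq0.
move/eqP; rewrite fmorph_eq0 => /eqP/completed_class_eq0 nul.
(* [N] is a precision at which [g] is visibly nonzero; the terms of index [e * N] then determine the
   valuation [d < N] of [g] at [x]. *)
have [N gN] : exists N, ~ maxid_pow x N (g N).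
  apply: contrapT => nex; move/eqP: g0; apply; apply/completed_class_eq0 => n.
  by apply: contrapT => ng; apply: nex; exists n.
have gn : ~ maxid_pow x N (g (e * N)%N).
  move=> gn; apply: gN; rewrite -[g N](subKr (g (e * N)%N)).
  by apply: maxid_powB => //; apply: cseq_sub; rewrite leq_pmull.
have := nul (e * N)%N.
rewrite -[X in maxid_pow _ _ X]/(t * g (e * N)%N - f (e * N)%N).
have := cseqO f (e * N)%N; have := cseqO g (e * N)%N.
move: (f _) (g _) gn => F G nG xG xF FG.
have G0 : G != 0 by apply: contra_notN nG => /eqP->; exact: maxid_pow0.
have [d [v [v0 xv xvV GE]]] := uniformizer_decomp wU xG G0.
have dN : (d < N)%N.
  rewrite ltnNge; apply/negP => Nd; apply: nG; rewrite GE.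
  exact/(maxid_pow_unit _ _ wU v0 xv xvV).
have tG m : maxid_pow y m (t * G) <-> (m <= (e * d).+1)%N.
  rewrite (_ : t * G = v * u ^+ d * t ^+ (e * d).+1); last first.
    by rewrite GE wE exprMn -exprM exprS; ring.
  apply: maxid_pow_unit => //; first by rewrite mulf_neq0 // expf_neq0.
    by apply: dvrM; [exact: (over_sub yx)|exact: dvrX].
  by rewrite invfM -exprVn; apply: dvrM; [exact: (over_sub yx)|exact: dvrX].
have edN : (e * d.+1 <= e * N)%N by rewrite leq_mul2l dN orbT.
have lt_ed : (e * d < e * d.+1)%N by rewrite ltn_pmul2l.
have F1 : maxid_pow y (e * d).+1 F.
  rewrite -[F](subKr (t * G)); apply: maxid_powB; first exact/tG.
  exact: maxid_pow_le (leq_trans lt_ed edN) _ FG.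
have F2 : maxid_pow x d.+1 F.
  have [->|F0] := eqVneq F 0; first exact: maxid_pow0.
  have [l [v' [v'0 xv' xv'V FE]]] := uniformizer_decomp wU xF F0.
  rewrite FE; apply/(maxid_pow_unit _ _ wU v'0 xv' xv'V).
  rewrite -(ltn_pmul2l e0); move: F1; rewrite FE.
  by move/(maxid_pow_over_unit yx tU u0 yu yuV wE _ _ v'0 xv' xv'V).
have F3 : maxid_pow y (e * d.+1) F.
  by apply/(maxid_pow_over yx wU tU e0 u0 yu yuV wE).
have : maxid_pow y (e * d.+1) (t * G).
  by rewrite -[t * G](subrK F); apply: maxid_powD => //; exact: maxid_pow_le edN _ FG.
move=> /tG; rewrite mulnS -addn1 addnC leq_add2l => e1.
by apply/eqP; rewrite eqn_leq e1.
Qed.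

End EtaleIndex.

(** * Local conditions on covers in terms of completed fields *)

Section LocalCover.
Variables (k : closedFieldType) (Om : fieldType) (c : {rmorphism k -> Om}).
Variable C : smooth_affine_curve c.
Local Notation K := (function_field C).
Variable L : set Om.
Hypothesis Lgal : finite_galois K L.

Lemma completed_trivial_etale (y : closed_point c L) (x : closed_point c K)
    (yx : lies_over y x) (M : alg_closure (completed_field x)) :
  completed_field_in yx (range (ac_emb M)) -> etale_at y x.
Proof.
move=> [phi phiE phi_sub].
have [w wU] := dvr_uniformizer x.
have [e [t [u [e0 tU [u0 yu yuV] wE]]]] := ramification_exists yx wU.
have e1 := completed_trivial_index wU tU e0 u0 yu yuV wE phiE phi_sub.
exact: (index_etale wU tU u0 yuV wE e1).
Qed.

Lemma etale_completed_trivial (y : closed_point c L) (x : closed_point c K)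
    (yx : lies_over y x) (M : alg_closure (completed_field x)) :
  etale_at y x -> completed_field_in yx (range (ac_emb M)).
Proof.
move=> et; have [w wU] := dvr_uniformizer x.
have [e [t [u [e0 tU [u0 yu yuV] wE]]]] := ramification_exists yx wU.
have res z : y z -> exists a, maxid y (z - c a) by exact: (cover_residue Lgal).
have [phi [phiE phi_sub phi_triv]] :=
  embedding_exists yx wU tU e0 u0 yu yuV wE res (ac_emb M).
exists phi => //; apply: phi_sub => //; first exact: range_subfield.
exact/phi_triv/(etale_index yx wU tU e0 yu wE).
Qed.

(* The splitting field, over the completed field of [x], of the polynomials over
   [K] whose roots generate [L]. *)
Lemma local_galois_hull (x : closed_point c K)
    (M : alg_closure (completed_field x)) :
  exists E : set M, finite_galois (range (ac_emb M)) E /\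
    forall (y : closed_point c L) (yx : lies_over y x), completed_field_in yx E.
Proof.
have [Lfield KL [s sE] Lnorm] := Lgal.
have Kfield := function_field_subfield C.
have [Kt [iK iKE]] := subfield_type Kfield.
have [Lt [iL iLE]] := subfield_type Lfield.
have [|lamx lamxE] := @fractions_lift _ x Kt iK.
  by rewrite iKE point_fractions.
have K0 : K 0 by apply: mem_subring0; case: Kfield.
have K1 : K 1 by case: Kfield => -[].
have sL i : (i < size s)%N -> L s`_i.
  move=> si; rewrite sE; exists (fun l => if l == i then 1 else 0).
    by move=> l; case: ifP.
  rewrite (bigD1 (Ordinal si)) //= eqxx mul1r big1 ?addr0 // => l.
  by rewrite -val_eqE /= => /negPf->; rewrite mul0r.
have [rs [rsep rsP]] : exists rs : seq M,
    (forall z, z \in rs -> exists p : {poly completed_field x},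
       separable_poly p /\ root (map_poly (ac_emb M) p) z) /\
    forall i, (i < size s)%N -> exists P : {poly Kt}, root (map_poly iK P) s`_i /\
      forall z, root (map_poly (ac_emb M) (map_poly lamx P)) z -> z \in rs.
  elim: (s) sL => [|a s' IHs] sL; first by exists [::].
  have [i si|rs [rsep rsP]] := IHs; first exact: (sL i.+1).
  have [p [pK psep pa _]] := Lnorm a (sL 0%N isT).
  rewrite -iKE in pK; have [P PE] := (coefs_in_range _ _).1 pK.
  have [r rE] := closed_field_poly_normal (map_poly (ac_emb M) (map_poly lamx P)).
  have Psep : separable_poly (map_poly lamx P).
    by rewrite separable_map -(separable_map iK) -PE.
  have rP z : root (map_poly (ac_emb M) (map_poly lamx P)) z = (z \in r).
    rewrite rE rootZ ?root_prod_XsubC // lead_coef_eq0 map_poly_eq0.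
    exact: separable_poly_neq0.
  exists (r ++ rs); split=> [z|[|i] si].
  - rewrite mem_cat -rP => /orP[rz|/rsep//].
    by exists (map_poly lamx P).
  - by exists P; rewrite -PE; split=> // z; rewrite rP mem_cat => ->.
  - have [P' [P'a rP']] := rsP i si.
    by exists P'; split=> // z /rP'; rewrite mem_cat orbC => ->.
have [E [Egal Ers]] := galois_hull rsep.
exists E; split=> // y yx.
have [w wU] := dvr_uniformizer x.
have [e [t [u [e0 tU [u0 yu yuV] wE]]]] := ramification_exists yx wU.
have [yt _ _ _] := tU.
have res z : y z -> exists a, maxid y (z - c a) by exact: (cover_residue Lgal).
have [phi [phiE phi_sub _]] :=
  embedding_exists yx wU tU e0 u0 yu yuV wE res (ac_emb M).
have [Efield iE _ _] := Egal; have [Ering _] := Efield.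
exists phi => //; apply: phi_sub => //.
have [|lamy lamyE] := @fractions_lift _ y Lt iL.
  by rewrite iLE point_fractions.
have phi_class z : x z -> phi (dvr_class y z) = ac_emb M (dvr_class x z).
  move=> xz; rewrite (dvr_classE xz) -phiE; congr (phi _); apply/esym.
  by apply: dvr_class_eq => //; exact: (over_sub yx).
(* The embedding of [L] through the completion at [y] extends that of [K] through the completion at
   [x]. Hence it maps a root of a polynomial over [K] to a root of the corresponding polynomial over
   the completed field of [x]. *)
have compat (al : Kt) (be : Lt) : iK al = iL be ->
    phi (lamy be) = ac_emb M (lamx al).
  move=> ab; have : fractions x (iK al) by rewrite point_fractions -iKE; exists al.
  move=> /fractions_nonzero_denominator[a [b [xa xb b0 aE]]].
  rewrite (lamxE al a b) // (lamyE be a b) -?ab //; try exact: (over_sub yx).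
  by rewrite !fmorph_div /= !phi_class.
have Ls z : L z -> exists z', iL z' = z.
  by rewrite -iLE => -[z' _ <-]; exists z'.
have phi_s i z' : (i < size s)%N -> iL z' = s`_i -> E (phi (lamy z')).
  move=> si zE; have [P [Ps rP]] := rsP i si; apply/Ers/rP.
  have [P' PE] : exists P' : {poly Lt}, map_poly iK P = map_poly iL P'.
    apply/coefs_in_range => l; rewrite coef_map iLE; apply: KL.
    by rewrite -iKE; exists P`_l.
  have P'z : root P' z' by rewrite -(fmorph_root iL) -PE zE.
  have : root (map_poly phi (map_poly lamy P')) (phi (lamy z')).
    by rewrite !fmorph_root.
  congr (root _ _); apply/polyP => l; rewrite !coef_map /=; apply: compat.
  by have /(congr1 (coefp l)) := PE; rewrite /coefp !coef_map.
have Lt_t : L t by rewrite -(point_fractions y); exact: fractions_dvr.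
have [t' t'E] := Ls t Lt_t.
have -> : phi (dvr_class y t) = phi (lamy t').
  rewrite (lamyE t' t 1) ?dvr_class1 ?divr1 ?oner_eq0 //; exact: dvr1.
(* [t] is a combination of the generators of [L] with coefficients in [K]: the generators go to the
   adjoined roots, hence into [E], and the coefficients into the completed field of [x]. *)
have : L t by []; rewrite {1}sE => -[a aK tE].
have /choice[al alE] i : exists al, iK al = a i.
  by have := aK i; rewrite -iKE => -[al _ <-]; exists al.
have /choice[be beE] i : exists be, iL be = a i by apply: Ls; exact: KL.
have /choice[sg sgE] i : exists sg, (i < size s)%N -> iL sg = s`_i.
  have [si|_] := ltnP i (size s); last by exists 0.
  by have [z' z'E] := Ls _ (sL i si); exists z'.
have -> : t' = \sum_(i < size s) be i * sg i.
  apply: (fmorph_inj iL); rewrite t'E tE rmorph_sum; apply: eq_bigr => i _ /=.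
  by rewrite rmorphM /= beE sgE.
rewrite !rmorph_sum; apply: mem_subring_sum => // i _ /=.
rewrite !rmorphM /=; case: (Ering) => _ _; apply; last first.
  by apply: (phi_s i) => //; exact: sgE.
rewrite (compat (al i)) ?alE ?beE //; apply: iE; by exists (lamx (al i)).
Qed.

End LocalCover.

(** * Branch data of covers *)

Section BranchDataOfCovers.
Variables (k : closedFieldType) (Om : fieldType) (c : {rmorphism k -> Om}).
Variable C : smooth_affine_curve c.
Local Notation K := (function_field C).
Variable Kbar : forall x : closed_point c K, alg_closure (completed_field x).
Local Notation trivial x := (range (ac_emb (Kbar x))).

(** A branch datum is chosen point by point, subject to a requirement [R]. Taking the trivial
    extension off the finite set [S] is what makes the support finite. *)
Lemma branch_data_exists (S : set (closed_point c K))
    (R : forall x, set (Kbar x) -> Prop) : finite_set S ->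
  (forall x, S x -> exists E, finite_galois (trivial x) E /\ R x E) ->
  (forall x, ~ S x -> R x (trivial x)) ->
  exists P : branch_data Kbar, Supp P `<=` S /\ forall x, R x (P x).
Proof.
move=> Sfin RS RnS.
have ex x : exists E, [/\ finite_galois (trivial x) E, R x E
    & ~ S x -> E = trivial x].
  have [Sx|nSx] := pselect (S x).
    by have [E [Egal RE]] := RS x Sx; exists E; split.
  exists (trivial x); split=> //; last exact: RnS.
  exact/finite_galois_refl/range_subfield.
pose P x := projT1 (cid (ex x)).
have PP x : [/\ finite_galois (trivial x) (P x), R x (P x)
    & ~ S x -> P x = trivial x] by rewrite /P; case: cid.
have PS : Supp P `<=` S.
  by move=> x xP; apply: contrapT => nSx; apply: xP; case: (PP x) => _ _; apply.
exists (BranchData (fun x => let: And3 g _ _ := PP x in g)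
  (sub_finite_set PS Sfin)).
by split=> // x; have [] := PP x.
Qed.

Lemma branch_data_join (P P' : branch_data Kbar) :
  exists Q : branch_data Kbar,
    [/\ Supp Q `<=` Supp P `|` Supp P', branch_le P Q & branch_le P' Q].
Proof.
have [||x nPP'|Q [QS QP]] := @branch_data_exists (Supp P `|` Supp P')
  (fun x E => P x `<=` E /\ P' x `<=` E).
- by rewrite finite_setU; split; [exact: (branch_finite P)|exact: (branch_finite P')].
- move=> x _; have [E [Egal PE P'E]] :=
    galois_join (branch_galois P x) (branch_galois P' x).
  by exists E.
- have -> : P x = trivial x by apply: contrapT => nP; apply: nPP'; left.
  have -> : P' x = trivial x by apply: contrapT => nP; apply: nPP'; right.
  by split; exact: subset_refl.
- exists Q; split=> // x; by have [] := QP x.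
Qed.

Lemma etale_branch_data (L : galois_cover K) : etale_over C L ->
  exists P : branch_data Kbar, Supp P `<=` punctures C /\ essentially_etale P L.
Proof.
move=> Let.
have [||x nx|P [PS PP]] := @branch_data_exists (punctures C)
  (fun x E => forall (y : closed_point c L) (yx : lies_over y x),
    completed_field_in yx E).
- exact: finite_punctures.
- by move=> x _; exact/local_galois_hull/(cover_galois L).
- move=> y yx; apply: (etale_completed_trivial (cover_galois L)).
  by apply: Let => //; exact: contrapT.
- by exists P; split=> // y x yx; exact: PP.
Qed.

Lemma essentially_etale_over (P : branch_data Kbar) : Supp P `<=` punctures C ->
  essentially_etale P `<=` etale_over C.
Proof.
move=> PS L eL y x yx xC; have := eL y x yx.
have -> : P x = trivial x by apply: contrapT => /PS; apply.
exact: completed_trivial_etale.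
Qed.

End BranchDataOfCovers.

(** * Topology of the limits *)

Section Projections.
Variables (I : Type) (T : I -> topologicalType).

Lemma prod_topology_proj_continuous i :
  continuous (fun f : prod_topology T => f i : T i).
Proof.
move=> f U nU; have /cvg_sup/(_ i) cf : (nbhs f) --> (f : prod_topology T) by [].
apply: cf.
exact: (@initial_continuous _ _ (fun f : forall i, T i => f i) f U nU).
Qed.

Lemma continuous_prod_topology (X : topologicalType) (g : X -> prod_topology T) :
  (forall i, continuous (fun z => g z i : T i)) -> continuous g.
Proof.
move=> gi z; apply/cvg_sup => i.
exact: (@continuous_comp_initial _ _ _ (fun f : forall i, T i => f i) g (gi i)).
Qed.

Variables (S : choiceType) (h : S -> prod_topology T).

Lemma initial_proj_continuous i :
  continuous (fun s : initial_topology h => h s i : T i).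
Proof.
move=> s; apply: (@continuous_comp _ _ _ (h : initial_topology h -> prod_topology T)
  (fun f : prod_topology T => f i)).
  exact: initial_continuous.
exact: prod_topology_proj_continuous.
Qed.

Lemma continuous_to_initial_prod (X : topologicalType) (g : X -> initial_topology h) :
  (forall i, continuous (fun z => h (g z) i : T i)) -> continuous g.
Proof.
by move=> gi; apply: continuous_comp_initial; exact: continuous_prod_topology.
Qed.

End Projections.

Section LimitTopology.
Variables (k : closedFieldType) (Om : fieldType) (c : {rmorphism k -> Om}).
Variable K : set Om.

Lemma pi1_proj_continuous (Q : set (galois_cover K)) (L : {L | Q L}) :
  continuous (fun s : pi1 Q => s L : discrete_topology (aut (sval L))).
Proof.
exact: (@initial_proj_continuous _
  (fun L : {L | Q L} => discrete_topology (aut (sval L))) (pi1 Q)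
  (fun s : pi1 Q => fun L => s L) L).
Qed.

Lemma continuous_to_pi1 (Q : set (galois_cover K)) (X : topologicalType)
    (g : X -> pi1 Q) :
  (forall L : {L | Q L},
    continuous (fun z => g z L : discrete_topology (aut (sval L)))) ->
  continuous g.
Proof.
exact: (@continuous_to_initial_prod _
  (fun L : {L | Q L} => discrete_topology (aut (sval L))) (pi1 Q)
  (fun s : pi1 Q => fun L => s L) X g).
Qed.

Variable Kbar : forall x : closed_point c K, alg_closure (completed_field x).
Variable S : set (closed_point c K).
Local Notation index := {P : branch_data Kbar | Supp P `<=` S}.

Lemma lim_pi1_proj_continuous (P : index) :
  continuous (fun s : lim_pi1 Kbar S => s P : pi1 (essentially_etale (sval P))).
Proof.
exact: (@initial_proj_continuous _
  (fun P : index => pi1 (essentially_etale (sval P))) (lim_pi1 Kbar S)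
  (fun s : lim_pi1 Kbar S => fun P => s P) P).
Qed.

Lemma continuous_to_lim_pi1 (X : topologicalType) (g : X -> lim_pi1 Kbar S) :
  (forall P : index,
    continuous (fun z => g z P : pi1 (essentially_etale (sval P)))) ->
  continuous g.
Proof.
exact: (@continuous_to_initial_prod _
  (fun P : index => pi1 (essentially_etale (sval P))) (lim_pi1 Kbar S)
  (fun s : lim_pi1 Kbar S => fun P => s P) X g).
Qed.

Lemma pi1_trans_continuous (Q Q' : set (galois_cover K)) (QQ' : Q' `<=` Q) :
  continuous (pi1_trans QQ').
Proof.
apply: continuous_to_pi1 => L.
exact: (@pi1_proj_continuous Q (exist (fun L => Q L) (sval L) (QQ' _ (svalP L)))).
Qed.

End LimitTopology.

(** * Comparison of the two limits by restriction of automorphisms *)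

Theorem theorem2p40 (k : closedFieldType) (Om : fieldType)
    (c : {rmorphism k -> Om}) (C : smooth_affine_curve c)
    (OmP : separable_closure (function_field C))
    (Kbar : forall x : closed_point c (function_field C),
      alg_closure (completed_field x)) :
  exists phi : pi1_etale C -> lim_pi1 Kbar (punctures C),
    [/\ (forall (s : pi1_etale C)
                (P : {P : branch_data Kbar | Supp P `<=` punctures C}),
          exists h : essentially_etale (sval P) `<=` etale_over C,
            phi s P = pi1_trans h s),
        {morph phi : s t / (s * t)%g},
        continuous phi
      & exists psi : lim_pi1 Kbar (punctures C) -> pi1_etale C,
          [/\ cancel phi psi, cancel psi phi & continuous psi]].
Proof.
pose index := {P : branch_data Kbar | Supp P `<=` punctures C}.
have sub (P : index) : essentially_etale (sval P) `<=` etale_over C.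
  exact/essentially_etale_over/(svalP P).
have phi_compat s (P P' : index) (PP' : branch_le (sval P') (sval P)) :
    pi1_orbifold_trans PP' (pi1_trans (sub P) s) = pi1_trans (sub P') s.
  apply: pi1_ext => -[L eL] /=; congr (pi1_fun s (exist _ L _)).
  exact: Prop_irrelevance.
pose phi s : lim_pi1 Kbar (punctures C) :=
  LimPi1 (lim_pi1_fun := fun P => pi1_trans (sub P) s) (phi_compat s).
(* any two branch data are dominated by a third one *)
have agree (s : lim_pi1 Kbar (punctures C)) (P P' : index) L L' eL eL'
    (u : {z | cover_field L z}) (v : {z | cover_field L' z}) :
    L `<=` L' -> sval u = sval v ->
    sval (s P (exist _ L eL) u) = sval (s P' (exist _ L' eL') v).
  move=> LL' uv; have [Q [QS PQ P'Q]] := branch_data_join (sval P) (sval P').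
  have QC : Supp Q `<=` punctures C.
    by apply: subset_trans QS _ => x [/(svalP P)|/(svalP P')].
  rewrite -(lim_pi1_compat s (P := exist _ Q QC) (P' := P) PQ).
  rewrite -(lim_pi1_compat s (P := exist _ Q QC) (P' := P') P'Q) /=.
  exact: (pi1_compat _ (L := exist _ L _) (L' := exist _ L' _)).
have bd (L : {L | etale_over C L}) :
    exists P : index, essentially_etale (sval P) (sval L).
  by have [P [PS eP]] := etale_branch_data Kbar (svalP L); exists (exist _ P PS).
(* [B L] is an arbitrary choice of a branch datum dominating [L]. No compatibility between the
   choices is needed, because [agree] compares components over different branch data. *)
pose B L := projT1 (cid (bd L)).
have BP L : essentially_etale (sval (B L)) (sval L) by rewrite /B; case: cid.
have psi_compat (s : lim_pi1 Kbar (punctures C)) (L L' : {L | etale_over C L})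
    (u : {z | sval L z}) (v : {z | sval L' z}) :
    sval L `<=` sval L' -> sval u = sval v ->
    sval (s (B L) (exist _ (sval L) (BP L)) u)
      = sval (s (B L') (exist _ (sval L') (BP L')) v).
  exact: agree.
pose psi (s : lim_pi1 Kbar (punctures C)) : pi1_etale C :=
  Pi1 (pi1_fun := fun L => s (B L) (exist _ (sval L) (BP L))) (psi_compat s).
exists phi; split.
- by move=> s P; exists (sub P).
- by move=> s t; apply: lim_pi1_ext => P; exact: pi1_ext.
- by apply: continuous_to_lim_pi1 => P; exact: pi1_trans_continuous.
exists psi; split.
- move=> s; apply: pi1_ext => -[L eL] /=.
  congr (pi1_fun s (exist _ L _)); exact: Prop_irrelevance.
(* The inverse reads the component at [L] off [B L'] instead of [P]; [agree] identifies the two. *)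
- move=> s; apply: lim_pi1_ext => P; apply: pi1_ext => -[L eL].
  apply: aut_ext => u; apply: carrier_inj.
  pose L' : {L | etale_over C L} :=
    exist _ L (sub P L (svalP (exist (fun L => essentially_etale (sval P) L) L eL))).
  exact: (agree s (B L') P L L (BP L') eL u u).
- apply: continuous_to_pi1 => L s.
  apply: (@continuous_comp _ _ _ (fun s : lim_pi1 Kbar (punctures C) => s (B L))
    (fun r : pi1_orbifold (sval (B L)) =>
       r (exist _ (sval L) (BP L)) : discrete_topology (aut (sval L)))).
    exact: lim_pi1_proj_continuous.
  exact: (@pi1_proj_continuous _ _ (essentially_etale (sval (B L)))
    (exist _ (sval L) (BP L)) (s (B L))).
Qed.
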